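(* Let $k$ be a local field with normalized discrete valuation $v$, ring of integers $\mathcal{O}$ and finite residue field. Let $F(x)\in\mathcal{O}[x]$ be monic irreducible separable of degree $n$, $\theta$ a root, $L=k(\theta)$, and assume $L/k$ is wildly ramified. Let $[\phi_1,\dots,\phi_r]$ be an Okutsu frame of $F$ and let $\phi\in\mathcal{O}[x]$ be an Okutsu approximation to $F$ with $h_\phi>\rho(F)$. Then $\rho(\phi)=\rho(F)$. In particular, if $L'/k$ is the extension generated by a root of $\phi$, then $v_{\mathfrak{m}_L}(\operatorname{Diff}(L/k))=v_{\mathfrak{m}_{L'}}(\operatorname{Diff}(L'/k))$.
   Context: $v$ is extended canonically to $\overline{k}$ with $v(k^* )=\mathbb{Z}$; $\mathfrak{m}_L,\mathfrak{m}_{L'}$ are the maximal ideals of the rings of integers, $v_{\mathfrak{m}_L},v_{\mathfrak{m}_{L'}}$ the normalized valuations, $\operatorname{Diff}$ the different ideal. Okutsu frame: monic separable $\phi_1,\dots,\phi_r\in\mathcal{O}[x]$ ($r\ge0$) with $m_i=\deg\phi_i$, $1\le m_1<\dots<m_r<n$, such that, setting $m_0=1,\phi_0=1$, $m_{r+1}=n$, and letting $\phi_{r+1}$ be any monic separable polynomial of degree $n$ with $v(\phi_{r+1}(\theta))/n>v(\phi_r(\theta))/m_r$, for every monic $g\in\mathcal{O}[x]$ and $0\le i\le r$: $m_i\le\deg g<m_{i+1}$ implies $v(g(\theta))/\deg g\le v(\phi_i(\theta))/m_i<v(\phi_{i+1}(\theta))/m_{i+1}$. An Okutsu approximation to $F$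 is a monic separable $\phi\in\mathcal{O}[x]$ of degree $n$ with $v(\phi(\theta))/n>v(\phi_r(\theta))/m_r$. It is known that such $\phi$ is irreducible and $[\phi_1,\dots,\phi_r]$ is also an Okutsu frame of $\phi$ (with $F$ an Okutsu approximation to $\phi$). For a monic irreducible separable $G\in\mathcal{O}[x]$ of degree $n$ with root $\eta$ and Okutsu frame $[\phi_1,\dots,\phi_r]$, with $\phi_{r+1}$ an Okutsu approximation to $G$: MacLane valuations $v^G_1(\sum_jc_jx^j):=\min_jv(c_j)$; for $1\le i\le r$, given $v^G_i$, write $g=\sum_sa_s\phi_i^s$ ($\deg a_s<m_i$), $V_i:=v^G_i(\phi_i)$, $N_i(g)$ the lower convex hull of $(s,v^G_i(a_s)+sV_i)$; it is known that $N_i(G)$ is one segment of slope $-h_i/e_i$ ($h_i,e_i$ coprime positive integers), and $v^G_{i+1}(g):=e_i\min_s\{v^G_i(a_s)+sV_i+sh_i/e_i\}$. Let $\mu(G):=\max\{v(g(\eta)) : g\in\mathcal{O}[x]\text{ monic},\deg g<n\}$, $e(G)$ the ramification index of $k(\eta)/k$, and $\rho(G):=v^G_{r+1}(G')-e(G)\mu(G)$. Finally $h_\phi:=v^F_{r+1}(F-\phi)-v^F_{r+1}(\phi)$ (a positive integer). *)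

(* Defs.v *)
From HB Require Import structures.
From mathcomp Require Import all_boot all_order all_algebra all_field.
From mathcomp Require Import boolp classical_sets cardinality constructive_ereal.

Set Implicit Arguments.
Unset Strict Implicit.
Unset Printing Implicit Defensive.

Import Order.TTheory GRing.Theory Num.Theory.

#[global] Open Scope classical_set_scope.
#[global] Open Scope card_scope.
#[global] Open Scope ring_scope.

(* Valuations take values in \bar rat, with v 0 = +oo; -oo is excluded. *)
Record valuation (K : fieldType) (v : K -> \bar rat) : Prop := Valuation {
  valuationNy : forall x, v x <> -oo%E;
  valuation0P : forall x, v x = +oo%E <-> x = 0;
  valuationM : forall x y, v (x * y) = (v x + v y)%E;
  valuationD : forall x y, (Order.min (v x) (v y) <= v (x + y)%R)%E
}.

Definition value_group (K : fieldType) (v : K -> \bar rat) (L : set K) :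
    set rat :=
  [set r | exists2 x, L x & v x = r%:E].

Definition base_field (k K : fieldType) (iota : {rmorphism k -> K}) : set K :=
  range iota.

Definition complete (k : fieldType) (v : k -> \bar rat) : Prop :=
  forall u : nat -> k,
    (forall M : rat, exists N, forall i j, (N <= i)%N -> (N <= j)%N ->
       (M%:E < v (u i - u j)%R)%E) ->
    exists l : k, forall M : rat, exists N, forall i, (N <= i)%N ->
       (M%:E < v (u i - l)%R)%E.

Definition finite_residue_field (k : fieldType) (v : k -> \bar rat) : Prop :=
  exists s : seq k, forall x, (0 <= v x)%E ->
    exists y, y \in s /\ (0 <= v y)%E /\ (0 < v (x - y)%R)%E.

(* k is a local field, iota embeds it in an algebraic closure K, and v is the
   extension to K of the normalized valuation v \o iota of k; by completeness
   there is only one such extension. *)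
Record local_field (k : fieldType) (K : closedFieldType)
    (iota : {rmorphism k -> K}) (v : K -> \bar rat) : Prop := LocalField {
  local_algebraic : forall x : K, algebraicOver iota x;
  local_valuation : valuation v;
  local_normalized : value_group v (base_field iota) = range (intr : int -> rat);
  local_complete : complete (v \o iota);
  local_residue : finite_residue_field (v \o iota)
}.

Definition maximum (A : set (\bar rat)) : \bar rat :=
  xget 0%E [set m | A m /\ forall a, A a -> (a <= m)%E].

Definition minimum (A : set (\bar rat)) : \bar rat :=
  xget 0%E [set m | A m /\ forall a, A a -> (m <= a)%E].

Definition deg (R : nzRingType) (p : {poly R}) : nat := (size p).-1.

Definition peval (k K : fieldType) (iota : {rmorphism k -> K}) (g : {poly k})
    (x : K) : K := (map_poly iota g).[x].

Definition integral_coefs (k K : fieldType) (iota : {rmorphism k -> K})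
    (v : K -> \bar rat) (g : {poly k}) : Prop :=
  forall i, (0 <= v (iota g`_i))%E.

(* k(x) *)
Definition adjoin (k K : fieldType) (iota : {rmorphism k -> K}) (x : K) :
    set K :=
  [set y | exists g h : {poly k},
     peval iota h x != 0 /\ y = peval iota g x / peval iota h x].

(* The index of v(k^* ) in v(L^* ), as the number of cosets. *)
Definition ramification_index (k K : fieldType) (iota : {rmorphism k -> K})
    (v : K -> \bar rat) (L : set K) : nat :=
  let coset (r : rat) := [set s | value_group v (base_field iota) (s - r)] in
  xget 0%N [set e | [set coset r | r in value_group v L] #= `I_e].

Definition wildly_ramified (k K : fieldType) (iota : {rmorphism k -> K})
    (v : K -> \bar rat) (L : set K) : Prop :=
  exists p : nat, [/\ prime p, (0 < v p%:R)%E
    & (p %| ramification_index iota v L)%N].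

Definition valuation_ring (K : fieldType) (v : K -> \bar rat) (L : set K) :
    set K := [set x | L x /\ (0 <= v x)%E].

Definition is_basis (k K : fieldType) (iota : {rmorphism k -> K}) (L : set K)
    (n : nat) (b : 'I_n -> K) : Prop :=
  (forall i, L (b i)) /\
  forall y, L y -> exists! c : 'rV[k]_n, y = \sum_(i < n) iota (c 0 i) * b i.

(* Tr_{L/k}(x) is the trace of the matrix of multiplication by x in a
   k-basis of L. *)
Definition field_trace (k K : fieldType) (iota : {rmorphism k -> K})
    (L : set K) (x : K) : k :=
  xget 0 [set t | exists n (b : 'I_n -> K) (M : 'M[k]_n),
    [/\ is_basis iota L b,
        forall i, x * b i = \sum_(j < n) iota (M i j) * b j
      & t = \tr M]].

Definition codifferent (k K : fieldType) (iota : {rmorphism k -> K})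
    (v : K -> \bar rat) (L : set K) : set K :=
  [set x | L x /\ forall y, valuation_ring v L y ->
     (0 <= v (iota (field_trace iota L (x * y)%R)))%E].

Definition different (k K : fieldType) (iota : {rmorphism k -> K})
    (v : K -> \bar rat) (L : set K) : set K :=
  [set y | L y /\ forall x, codifferent iota v L x ->
     valuation_ring v L (x * y)].

Definition normalized_valuation (k K : fieldType) (iota : {rmorphism k -> K})
    (v : K -> \bar rat) (L : set K) (x : K) : \bar rat :=
  ((ramification_index iota v L)%:R%:E * v x)%E.

Definition ideal_valuation (k K : fieldType) (iota : {rmorphism k -> K})
    (v : K -> \bar rat) (L I : set K) : \bar rat :=
  minimum [set normalized_valuation iota v L x | x in I].

(* For a frame [phi_1, .., phi_r], frame_val .. i is v(phi_i(theta)) / m_i,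
   0 <= i <= r + 1, where phi_0 = 1, m_0 = 1 and phi_{r+1} is the extra
   argument phi. *)
Definition frame_deg (k : fieldType) (s : seq {poly k}) (phi : {poly k})
    (i : nat) : nat :=
  nth 1%N (1%N :: map (@deg k) (rcons s phi)) i.

Definition frame_poly (k : fieldType) (s : seq {poly k}) (phi : {poly k})
    (i : nat) : {poly k} :=
  nth 1 (1 :: rcons s phi) i.

Definition frame_val (k K : fieldType) (iota : {rmorphism k -> K})
    (v : K -> \bar rat) (theta : K) (s : seq {poly k}) (phi : {poly k})
    (i : nat) : \bar rat :=
  (v (peval iota (frame_poly s phi i) theta)
     * ((frame_deg s phi i)%:R^-1)%:E)%E.

Definition okutsu_approximation (k K : fieldType) (iota : {rmorphism k -> K})
    (v : K -> \bar rat) (F : {poly k}) (theta : K) (s : seq {poly k})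
    (phi : {poly k}) : Prop :=
  [/\ integral_coefs iota v phi, phi \is monic, separable_poly phi,
      deg phi = deg F
    & (frame_val iota v theta s phi (size s)
         < frame_val iota v theta s phi (size s).+1)%E].

Definition okutsu_frame (k K : fieldType) (iota : {rmorphism k -> K})
    (v : K -> \bar rat) (F : {poly k}) (theta : K) (s : seq {poly k}) : Prop :=
  [/\ forall f, f \in s ->
        [/\ integral_coefs iota v f, f \is monic & separable_poly f],
      path ltn 0%N (rcons (map (@deg k) s) (deg F))
    & forall phi, okutsu_approximation iota v F theta s phi ->
      forall g : {poly k}, integral_coefs iota v g -> g \is monic ->
      forall i, (i <= size s)%N ->
        (frame_deg s phi i <= deg g < frame_deg s phi i.+1)%N ->
        (v (peval iota g theta) * ((deg g)%:R^-1)%:E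
           <= frame_val iota v theta s phi i)%E /\
        (frame_val iota v theta s phi i
           < frame_val iota v theta s phi i.+1)%E].

(* Coefficient of phi^s in the phi-adic expansion of g. *)
Definition adic_coef (k : fieldType) (phi g : {poly k}) (s : nat) : {poly k} :=
  (g %/ phi ^+ s) %% phi.

Lemma size_adic_coef (k : fieldType) (phi g : {poly k}) (s : nat) :
  phi != 0 -> (size (adic_coef phi g s) < size phi)%N.
Proof. by move=> phi0; rewrite ltn_modp. Qed.

Lemma adic_expansion (k : fieldType) (phi g : {poly k}) :
  (1 < size phi)%N ->
  g = \sum_(s < size g) adic_coef phi g s * phi ^+ s.
Proof.
move=> phi1; have phi0 : phi != 0 by rewrite -size_poly_gt0 ltnW.
have H n : g = (g %/ phi ^+ n) * phi ^+ n
               + \sum_(s < n) adic_coef phi g s * phi ^+ s.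
  elim: n => [|n IH]; first by rewrite big_ord0 addr0 expr0 divp1 mulr1.
  rewrite big_ord_recr /= addrCA addrC {1}IH; congr (_ + _).
  rewrite {1}(divp_eq (g %/ phi ^+ n) phi) mulrDl; congr (_ + _).
  by rewrite divp_divl -exprSr exprS mulrA.
rewrite {1}(H (size g)) divp_small ?mul0r ?add0r //.
rewrite -[X in (_ < X)%N]prednK ?size_poly_gt0 ?expf_neq0 //.
by rewrite size_exp ltnS leq_pmull // -subn1 subn_gt0.
Qed.

Definition newton_points (k : fieldType) (w : {poly k} -> \bar rat)
    (phi g : {poly k}) : set (rat * rat) :=
  [set P | exists2 s : nat, P.1 = s%:R
     & (w (adic_coef phi g s) + s%:R%:E * w phi)%E = P.2%:E].

Definition convex_hull (A : set (rat * rat)) : set (rat * rat) :=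
  [set P | exists n (q : 'I_n -> rat * rat) (c : 'I_n -> rat),
     [/\ forall i, A (q i), forall i, 0 <= c i, \sum_(i < n) c i = 1,
         P.1 = \sum_(i < n) c i * (q i).1 & P.2 = \sum_(i < n) c i * (q i).2]].

Definition lower_hull (A : set (rat * rat)) : set (rat * rat) :=
  [set P | convex_hull A P /\ forall y, convex_hull A (P.1, y) -> P.2 <= y].

Definition newton_polygon (k : fieldType) (w : {poly k} -> \bar rat)
    (phi g : {poly k}) : set (rat * rat) :=
  lower_hull (newton_points w phi g).

Definition segment_of_slope (A : set (rat * rat)) (a : rat) : Prop :=
  exists P Q : rat * rat,
    [/\ P.1 < Q.1, A = convex_hull [set P; Q] & Q.2 - P.2 = a * (Q.1 - P.1)].

(* The h / e > 0 for which the Newton polygon of G is a single segment of slope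
   - h / e; numq and denq then give h and e. *)
Definition newton_slope (k : fieldType) (w : {poly k} -> \bar rat)
    (phi G : {poly k}) : rat :=
  xget 0 [set l | segment_of_slope (newton_polygon w phi G) (- l)].

Definition gauss_valuation (k K : fieldType) (iota : {rmorphism k -> K})
    (v : K -> \bar rat) (g : {poly k}) : \bar rat :=
  \big[Order.min/+oo%E]_(j < size g) v (iota g`_j).

Definition maclane_step (k : fieldType) (G : {poly k})
    (w : {poly k} -> \bar rat) (phi : {poly k}) : {poly k} -> \bar rat :=
  let l := newton_slope w phi G in
  fun g => ((denq l)%:~R%:E * \big[Order.min/+oo]_(s < size g)
    (w (adic_coef phi g s) + s%:R%:E * w phi + (s%:R * l)%:E))%E.

(* v^G_{r+1} for the frame s = [phi_1, .., phi_r]. *)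
Definition maclane (k K : fieldType) (iota : {rmorphism k -> K})
    (v : K -> \bar rat) (G : {poly k}) (s : seq {poly k}) :
    {poly k} -> \bar rat :=
  foldl (maclane_step G) (gauss_valuation iota v) s.

Definition mu (k K : fieldType) (iota : {rmorphism k -> K})
    (v : K -> \bar rat) (G : {poly k}) (eta : K) : \bar rat :=
  maximum [set r | exists g : {poly k},
    [/\ integral_coefs iota v g, g \is monic, (deg g < deg G)%N
      & r = v (peval iota g eta)]].

Definition rho (k K : fieldType) (iota : {rmorphism k -> K})
    (v : K -> \bar rat) (s : seq {poly k}) (G : {poly k}) (eta : K) :
    \bar rat :=
  (maclane iota v G s G^`()
     - (ramification_index iota v (adjoin iota eta))%:R%:E * mu iota v G eta)%E.

(* Equal to +oo when phi = F. *)
Definition hphi (k K : fieldType) (iota : {rmorphism k -> K})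
    (v : K -> \bar rat) (s : seq {poly k}) (F phi : {poly k}) : \bar rat :=
  (maclane iota v F s (F - phi)%R - maclane iota v F s phi)%E.

(* Main.v *)
Require Import Defs.
From mathcomp Require Import all_boot all_order all_algebra all_field.
From mathcomp Require Import boolp classical_sets cardinality constructive_ereal.
From mathcomp Require Import ring lra zify.

Set Implicit Arguments.
Unset Strict Implicit.
Unset Printing Implicit Defensive.

Import Order.TTheory GRing.Theory Num.Theory.

(** For a root theta of F and a rational d, let w_d be the Gauss valuation of
    K[x] centred at theta with v(x - theta) = d; on a monic polynomial with
    roots b it is the sum of the min(v(theta - b), d). As k is complete,
    conjugate elements have the same value, so w_d restricted to k[x] does not
    depend on the choice of theta.

    If g is irreducible and d is the largest value of theta' - b, for theta' a
    conjugate of theta and b a root of g, then v(g(theta)) / deg g =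
    w_d(F) / n, which is strictly increasing in d. Hence the polynomials phi_i
    of an Okutsu frame are irreducible and the d_i attached to them are the
    successive maxima of d over polynomials of bounded degree. It follows that
    v_{i+1} = e_1 .. e_i w_{d_i}, that e_1 .. e_r is the ramification index,
    and that w_{d_r}(g) = v(g(theta)) when deg g < n.

    An Okutsu approximation phi has its roots at distance > d_r from the
    conjugates of theta, so it is irreducible and v(g(eta)) = v(g(theta)) when
    deg g < n. Lagrange interpolation gives mu(F) <= w_{d_r}(F) - d_r, and
    v(g'(theta)) >= v(g(theta)) - d_r for g = F - phi, so that h_phi > rho(F)
    forces v(phi'(theta)) = v(F'(theta)), whence rho(phi) = rho(F). By Euler's
    formula Tr(g(theta) / F'(theta)) is the coefficient of x^(n-1) in g, so the
    different is determined by v(F'(theta)) and the values v(g(theta)) for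
    deg g < n. *)

(** * Valuations and Gauss valuations *)

(** Slopes see distances through a resultant: expanding that of F and an irreducible g over the
    roots of either gives n v(g(theta)) = deg g v(F(b)) for a root b of g, and v(F(b)) = w_d(F)
    because, seen from the root of F closest to b, distances to b are distances between roots of F
    truncated at d. MacLane's minimum is w_{d_i} because polynomials of degree below deg phi_i have
    no root b with v(theta - b) >= d_i: their leading forms are constant, that of phi_i is not, and
    the terms of a phi_i-adic expansion cannot cancel. The obstacle to bounding mu(F) is that
    conjugates may be closer than d_r; interpolation at the conjugates themselves would only lead to
    v(F'(theta)). They are first moved inside their balls v(x - y) >= d_r, which truncates their
    mutual distances at d_r. This bound is what fits the hypothesis: divided by e(F), h_phi > rho(F)
    reads v(g(theta)) - w_{d_r}(F) > v(F'(theta)) - mu(F), so v(g(theta)) - d_r > v(F'(theta)), and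
    g' cannot disturb F' at theta. *)

Section Valuations.
Variables (K : fieldType) (v : K -> \bar rat).
Hypothesis vV : valuation v.
Implicit Types (x y : K) (c d : rat).

(** [fine] sends [v 0 = +oo] to 0, hence the nonvanishing hypotheses below; in exchange, rational
    arithmetic applies. *)
Definition rval x : rat := fine (v x).

Lemma v0 : v 0 = +oo%E.
Proof. exact/(valuation0P vV). Qed.

Lemma vE x : x != 0 -> v x = (rval x)%:E.
Proof.
move=> x0; rewrite /rval; have := @valuationNy _ _ vV x.
case E: (v x) => [r||] //= _; move/(valuation0P vV): E x0 => ->.
by rewrite eqxx.
Qed.

Lemma v_fin_neq0 x c : v x = c%:E -> x != 0.
Proof. by move=> xc; apply/eqP => x0; move: xc; rewrite x0 v0. Qed.

Lemma rvalE x c : v x = c%:E -> rval x = c.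
Proof. by rewrite /rval => ->. Qed.

Lemma rvalM x y : x != 0 -> y != 0 -> rval (x * y) = rval x + rval y.
Proof. by move=> x0 y0; rewrite /rval (valuationM vV) !vE. Qed.

Lemma rval1 : rval 1 = 0.
Proof. by have := rvalM (oner_neq0 K) (oner_neq0 K); rewrite mulr1; lra. Qed.

Lemma v1 : v 1 = 0%:E.
Proof. by rewrite vE ?oner_eq0 // rval1. Qed.

Lemma vN x : v (- x) = v x.
Proof.
have n0 : (-1 : K) != 0 by rewrite oppr_eq0 oner_eq0.
have := rvalM n0 n0; rewrite mulrNN mulr1 rval1 => h.
rewrite -mulN1r (valuationM vV) (vE n0).
have -> : rval (-1) = 0 by lra.
exact: add0e.
Qed.

Lemma v_subC x y : v (x - y) = v (y - x).
Proof. by rewrite -vN opprB. Qed.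

Lemma rvalV x : x != 0 -> rval x^-1 = - rval x.
Proof.
move=> x0; have := rvalM x0 (invr_neq0 x0).
by rewrite divff // rval1; lra.
Qed.

Lemma rvalX x n : x != 0 -> rval (x ^+ n) = n%:R * rval x.
Proof.
move=> x0; elim: n => [|n IH]; first by rewrite expr0 rval1 mul0r.
by rewrite exprS rvalM ?expf_neq0 // IH -[n.+1%:R]natr1; lra.
Qed.

Lemma rval_prod (I : Type) (r : seq I) (P : pred I) (f : I -> K) :
  (forall i, P i -> f i != 0) ->
  rval (\prod_(i <- r | P i) f i) = \sum_(i <- r | P i) rval (f i).
Proof.
move=> f0; elim: r => [|i r IH]; first by rewrite !big_nil rval1.
rewrite !big_cons; case: ifP => Pi //; rewrite rvalM ?IH ?f0 //.
by elim/big_ind: _; [exact: oner_neq0 | exact: mulf_neq0 | exact: f0].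
Qed.

Lemma vge_add (c : \bar rat) x y : (c <= v x -> c <= v y -> c <= v (x + y)%R)%E.
Proof.
move=> cx cy; apply: le_trans (valuationD vV x y).
by rewrite le_min cx cy.
Qed.

Lemma vgt_add (c : \bar rat) x y : (c < v x -> c < v y -> c < v (x + y)%R)%E.
Proof.
move=> cx cy; apply: lt_le_trans (valuationD vV x y).
by rewrite lt_min cx cy.
Qed.

Lemma vge_sub (c : \bar rat) x y : (c <= v x -> c <= v y -> c <= v (x - y)%R)%E.
Proof. by move=> cx cy; apply: vge_add => //; rewrite vN. Qed.

Lemma vge_sum (c : \bar rat) (I : Type) (r : seq I) (P : pred I) (f : I -> K) :
  (forall i, P i -> (c <= v (f i))%E) -> (c <= v (\sum_(i <- r | P i) f i)%R)%E.
Proof.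
move=> h; elim/big_ind : _ => //; first by rewrite v0 leey.
by move=> x y; apply: vge_add.
Qed.

Lemma vgt_sum c (I : Type) (r : seq I) (P : pred I) (f : I -> K) :
  (forall i, P i -> (c%:E < v (f i))%E) ->
  (c%:E < v (\sum_(i <- r | P i) f i)%R)%E.
Proof.
move=> h; elim/big_ind : _ => //; first by rewrite v0 ltry.
by move=> x y; apply: vgt_add.
Qed.

Lemma vge_mul c d x y :
  (c%:E <= v x -> d%:E <= v y -> (c + d)%:E <= v (x * y)%R)%E.
Proof. by move=> cx dy; rewrite (valuationM vV) EFinD leeD. Qed.

Lemma vgt_ge_mul c d x y :
  (c%:E < v x -> d%:E <= v y -> (c + d)%:E < v (x * y)%R)%E.
Proof. by move=> cx dy; rewrite (valuationM vV) EFinD lte_leD. Qed.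

Lemma vge_gt_mul c d x y :
  (c%:E <= v x -> d%:E < v y -> (c + d)%:E < v (x * y)%R)%E.
Proof. by move=> cx dy; rewrite mulrC addrC vgt_ge_mul. Qed.

Lemma veq_mul c d x y : v x = c%:E -> v y = d%:E -> v (x * y) = (c + d)%:E.
Proof. by move=> cx dy; rewrite (valuationM vV) cx dy. Qed.

Lemma v_add_lt x y : (v x < v y)%E -> v (x + y) = v x.
Proof.
move=> xy; apply: le_anti; apply/andP; split; last first.
  by apply: vge_add => //; exact: ltW.
rewrite leNgt; apply/negP => h.
suff : (v x < v x)%E by rewrite ltxx.
by rewrite -{2}(addrK y x); apply: vgt_add => //; rewrite vN.
Qed.

Lemma vgeP c x : x != 0 -> (c%:E <= v x)%E = (c <= rval x).
Proof. by move=> x0; rewrite (vE x0) lee_fin. Qed.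

Lemma v_le_fin x c : (v x <= c%:E)%E -> x != 0.
Proof. by apply: contraTneq => ->; rewrite v0 leye_eq. Qed.

Lemma v_infty x : (forall c, (c%:E <= v x)%E) -> x = 0.
Proof.
move=> h; apply/eqP; apply/negP => /negP x0.
by move: (h (rval x + 1)); rewrite vgeP //; lra.
Qed.

End Valuations.

Section GaussValuation.
Variables (K : fieldType) (v : K -> \bar rat).
Hypothesis vV : valuation v.
Implicit Types (P Q : {poly K}) (c d : rat) (t u : nat).

(* The Gauss valuation giving X the value d takes the value c at P, and t is
   the largest exponent whose term attains it, that is, the number of roots of
   P of value at least d. *)
Definition gaussv d P c t : Prop :=
  [/\ forall i, ((c - i%:R * d)%:E <= v P`_i)%E,
      v P`_t = (c - t%:R * d)%:E
    & forall i, (t < i)%N -> ((c - i%:R * d)%:E < v P`_i)%E].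

Lemma gaussv_neq0 d P c t : gaussv d P c t -> P != 0.
Proof. by case=> _ + _; apply: contraPneq => ->; rewrite coef0 (v0 vV). Qed.

Lemma gaussv_uniq d P c t c' t' : gaussv d P c t -> gaussv d P c' t' ->
  c = c' /\ t = t'.
Proof.
move=> [h1 h2 h3] [k1 k2 k3].
have cc : c = c'.
  move: (h1 t') (k1 t); rewrite h2 k2 !lee_fin => a b.
  by apply: le_anti; apply/andP; split; lra.
split=> //; subst c'; apply/eqP; rewrite eqn_leq; apply/andP; split.
  by rewrite leqNgt; apply/negP => /k3; rewrite h2 ltxx.
by rewrite leqNgt; apply/negP => /h3; rewrite k2 ltxx.
Qed.

(** With [c = c'] a smaller top still suffices: from index [t] on, the coefficients of [Q] lie
    strictly above the line of [P], so nothing cancels there. *)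
Lemma gaussvD d P c t Q c' t' : gaussv d P c t -> gaussv d Q c' t' ->
  c < c' \/ c = c' /\ (t' < t)%N -> gaussv d (P + Q) c t.
Proof.
move=> [h1 h2 h3] [k1 k2 k3] lt.
have cc : c <= c' by case: lt => [/ltW|[->]].
have kk i : ((c - i%:R * d)%:E <= v Q`_i)%E.
  by apply: le_trans (k1 i); rewrite lee_fin lerD2r.
have kkt i : (t <= i)%N -> ((c - i%:R * d)%:E < v Q`_i)%E.
  move=> ti; case: lt => [lt|[-> tt]]; last by apply: k3; exact: leq_trans ti.
  by apply: lt_le_trans (k1 i); rewrite lte_fin ltrD2r.
split=> [i||i ti]; rewrite coefD.
- exact: (vge_add vV).
- by rewrite (v_add_lt vV) h2 // kkt.
- by apply: (vgt_add vV); [exact: h3 | apply: kkt; exact: ltnW].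
Qed.

(** Gauss's lemma: among the pairs of indices with sum [t + t'], every pair other than [(t, t')] has
    an index past its top, so its product lies above the minimum. *)
Lemma gaussvM d P c t Q c' t' : gaussv d P c t -> gaussv d Q c' t' ->
  gaussv d (P * Q) (c + c') (t + t').
Proof.
move=> [h1 h2 h3] [k1 k2 k3].
have e i j : c + c' - (i + j)%:R * d = (c - i%:R * d) + (c' - j%:R * d).
  by rewrite natrD; ring.
have e' (i : nat) (j : 'I_i.+1) :
    c + c' - i%:R * d = (c - j%:R * d) + (c' - (i - j)%:R * d).
  by rewrite -e subnKC // -ltnS.
have term (i : nat) (j : 'I_i.+1) :
    ((c + c' - i%:R * d)%:E <= v (P`_j * Q`_(i - j))%R)%E.
  by rewrite (e' _ j); apply: (vge_mul vV).
have term' (i : nat) (j : 'I_i.+1) : (t < j)%N || (t' < i - j)%N ->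
    ((c + c' - i%:R * d)%:E < v (P`_j * Q`_(i - j))%R)%E.
  rewrite (e' _ j); case/orP=> lt.
    by apply: (vgt_ge_mul vV); [exact: h3 | exact: k1].
  by apply: (vge_gt_mul vV); [exact: h1 | exact: k3].
split=> [i||i ti]; rewrite coefM.
- exact: (vge_sum vV).
- have tt : (t < (t + t').+1)%N by rewrite ltnS leq_addr.
  rewrite (bigD1 (Ordinal tt)) //= addKn.
  have veq : v (P`_t * Q`_t') = (c + c' - (t + t')%:R * d)%:E.
    by rewrite e; apply: (veq_mul vV).
  rewrite (v_add_lt vV) veq //; apply: (vgt_sum vV) => j jt.
  apply: term'; have : (j != t :> nat) by [].
  by have := ltn_ord j; lia.
- by apply: (vgt_sum vV) => j _; apply: term'; have := ltn_ord j; lia.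
Qed.

Lemma gaussvC d a c : v a = c%:E -> gaussv d a%:P c 0.
Proof.
move=> ac; split=> [i||i i0]; rewrite coefC.
- by case: i => [|i] /=; rewrite ?ac ?(v0 vV) ?leey // lee_fin; lra.
- by rewrite eqxx ac; congr (_%:E); ring.
- by rewrite (gtn_eqF i0) (v0 vV) ltry.
Qed.

Lemma gaussvX d P c t n : gaussv d P c t -> gaussv d (P ^+ n) (n%:R * c) (t * n).
Proof.
move=> h; elim: n => [|n IH].
  by rewrite expr0 mul0r muln0; apply: gaussvC; exact: v1 vV.
rewrite exprS -natr1 mulrDl mul1r addrC mulnS.
exact: gaussvM.
Qed.

(** Truncation keeps the value rational at [b = 0], where it is [d]. *)
Definition minv d b : rat := if (d%:E <= v b)%E then d else rval v b.

(** The top is the truth value of [d <= v b] read as 0 or 1: exactly then the term of degree 1, of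
    value [d], attains the minimum. *)
Lemma gaussv_linear d b :
  gaussv d ('X + b%:P) (minv d b) ((d%:E <= v b)%E).
Proof.
have cf i : ('X + b%:P)`_i = if i is j.+1 then (j == 0%N)%:R else b :> K.
  by case: i => [|[|i]]; rewrite coefD coefX coefC //= ?add0r ?addr0.
rewrite /minv; case: ifPn => h; split=> [[|[|i]]||[|[|i]]] //=;
  rewrite ?cf /= ?(v1 vV) ?(v0 vV) ?leey ?ltry //.
- by rewrite mul0r subr0.
- by rewrite lee_fin; lra.
- by congr (_%:E); ring.
- rewrite mul0r subr0; move: h; rewrite -ltNge => h.
  by rewrite -(vE vV) //; apply: (v_le_fin vV); exact: ltW h.
- move: h; rewrite -ltNge => h; have b0 := v_le_fin vV (ltW h).
  by move: h; rewrite (vE vV b0) lte_fin lee_fin; lra.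
- move: h; rewrite -ltNge => h; have b0 := v_le_fin vV (ltW h).
  by rewrite (vE vV b0); congr (_%:E); ring.
- move=> _; move: h; rewrite -ltNge => h; have b0 := v_le_fin vV (ltW h).
  by move: h; rewrite (vE vV b0) !lte_fin; lra.
Qed.

Lemma minv_le d b : minv d b <= d.
Proof.
rewrite /minv; case: ifPn => // h; move: h; rewrite -ltNge => h.
have b0 := v_le_fin vV (ltW h).
by move: h; rewrite (vE vV b0) lte_fin => /ltW.
Qed.

Lemma minv_le_v d b : ((minv d b)%:E <= v b)%E.
Proof.
rewrite /minv; case: ifPn => // h; move: h; rewrite -ltNge => h.
by rewrite (vE vV) // (v_le_fin vV (ltW h)).
Qed.

Lemma minv_ge d b c : c <= d -> (c%:E <= v b)%E -> c <= minv d b.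
Proof.
move=> cd cb; rewrite /minv; case: ifPn => // h; move: h; rewrite -ltNge => h.
by have b0 := v_le_fin vV (ltW h); rewrite -(vgeP vV).
Qed.

Lemma minv_v d b : (v b <= d%:E)%E -> v b = (minv d b)%:E.
Proof.
move=> h; have b0 := v_le_fin vV h; rewrite /minv; case: ifPn => h'.
  by apply: le_anti; rewrite h h'.
exact: (vE vV).
Qed.

Lemma minv_mono d d' b : d <= d' -> minv d b <= minv d' b.
Proof.
by move=> dd; apply: minv_ge; [exact: le_trans (minv_le _ _) dd|exact: minv_le_v].
Qed.

Lemma minv_add d b b' : (d%:E <= v b')%E -> minv d (b + b') = minv d b.
Proof.
move=> h; apply: le_anti; apply/andP; split; apply: minv_ge; rewrite ?minv_le //.
  rewrite -[X in v X](addrK b' b); apply: (vge_sub vV); first exact: minv_le_v.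
  by apply: le_trans h; rewrite lee_fin minv_le.
apply: (vge_add vV); first exact: minv_le_v.
by apply: le_trans h; rewrite lee_fin minv_le.
Qed.

End GaussValuation.

(** * Roots *)

Section Shift.
Variables (K : fieldType).
Implicit Types (P Q : {poly K}) (e b : K).

Definition shift e P : {poly K} := P \Po ('X + e%:P).

Lemma shiftD e P Q : shift e (P + Q) = shift e P + shift e Q.
Proof. exact: comp_polyD. Qed.

Lemma shiftM e P Q : shift e (P * Q) = shift e P * shift e Q.
Proof. exact: comp_polyM. Qed.

Lemma shiftZ e (c : K) P : shift e (c *: P) = c *: shift e P.
Proof. exact: comp_polyZ. Qed.

Lemma shift_linear e b : shift e ('X - b%:P) = 'X + (e - b)%:P.
Proof. by rewrite /shift comp_polyB comp_polyX comp_polyC polyCB addrA. Qed.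

Lemma coef_shift e P i : (shift e P)`_i = P^`N(i).[e].
Proof.
have -> : shift e P = \sum_(j < size P) (P^`N(j).[e])%:P * 'X ^+ j.
  rewrite /shift comp_polyE; under eq_bigr do rewrite -mul_polyC.
  (* Taylor's formula over the ring of polynomials, at the constant [e] with increment ['X]. *)
  have := @nderiv_taylor _ (map_poly polyC P) e%:P 'X (mulrC _ _).
  rewrite size_map_polyC addrC horner_coef size_map_polyC => h.
  transitivity (\sum_(i0 < size P) (P ^:P)`_i0 * ('X + e%:P) ^+ i0).
    by apply: eq_bigr => j _; rewrite coef_map.
  rewrite h; apply: eq_bigr => j _; congr (_ * _).
  by rewrite nderivn_map horner_map.
rewrite coef_sum; case: (ltnP i (size P)) => iP.
  rewrite (bigD1 (Ordinal iP)) //= coefCM coefXn eqxx mulr1 big1 ?addr0 //.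
  by move=> j ji; rewrite coefCM coefXn eq_sym (negbTE (ji : j != i :> nat)) mulr0.
rewrite nderivn_poly0 // horner0 big1 // => j _.
by rewrite coefCM coefXn gtn_eqF ?mulr0 // (leq_trans (ltn_ord j)).
Qed.

Lemma coef0_shift e P : (shift e P)`_0 = P.[e].
Proof. by rewrite coef_shift nderivn0. Qed.

Lemma coef1_shift e P : (shift e P)`_1 = P^`().[e].
Proof. by rewrite coef_shift nderivn1. Qed.

End Shift.

Section Roots.
Variables (K : closedFieldType) (v : K -> \bar rat).
Hypothesis vV : valuation v.
Implicit Types (P Q : {poly K}) (c d : rat) (e b : K) (rs : seq K).

Definition prodX rs : {poly K} := \prod_(b <- rs) ('X - b%:P).

Definition rootsum e d rs : rat := \sum_(b <- rs) minv v d (e - b).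

Lemma root_prodX rs b : root (prodX rs) b = (b \in rs).
Proof. exact: root_prod_XsubC. Qed.

Lemma horner_prodX rs e : (prodX rs).[e] = \prod_(b <- rs) (e - b).
Proof. by rewrite horner_prod; apply: eq_bigr => b _; rewrite hornerXsubC. Qed.

Lemma prodX_factor P : P != 0 ->
  exists2 rs, P = lead_coef P *: prodX rs & forall b, root P b = (b \in rs).
Proof.
move=> P0; have [rs Prs] := closed_field_poly_normal P; exists rs => // b.
by rewrite Prs rootZ ?lead_coef_eq0 // root_prodX.
Qed.

Lemma monic_prodX P : P \is monic ->
  exists2 rs, P = prodX rs & size P = (size rs).+1.
Proof.
move=> Pm; have [rs Prs] := closed_field_poly_normal P; exists rs.
  by rewrite [LHS]Prs (monicP Pm) scale1r.
by rewrite [in LHS]Prs (monicP Pm) scale1r size_prod_XsubC.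
Qed.

Lemma gaussv_prodX e d rs :
  gaussv v d (shift e (prodX rs)) (rootsum e d rs)
    (count (fun b => d%:E <= v (e - b)%R)%E rs).
Proof.
rewrite /prodX /rootsum; elim: rs => [|b rs IH].
  rewrite !big_nil /= /shift comp_polyC; exact/gaussvC/v1.
by rewrite !big_cons shiftM shift_linear; apply: (gaussvM vV) => //;
   apply: gaussv_linear.
Qed.

Lemma gaussv_factor e d P rs : P != 0 -> P = lead_coef P *: prodX rs ->
  gaussv v d (shift e P) (rval v (lead_coef P) + rootsum e d rs)
    (count (fun b => d%:E <= v (e - b)%R)%E rs).
Proof.
move=> P0 Prs; rewrite [in shift e P]Prs shiftZ -mul_polyC -[count _ _]add0n.
apply: (gaussvM vV); last exact: gaussv_prodX.
by apply: (gaussvC vV); apply: (vE vV); rewrite lead_coef_eq0.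
Qed.

Lemma gaussv_exists e d P : P != 0 -> exists c t, gaussv v d (shift e P) c t.
Proof.
move=> P0; have [rs Prs _] := prodX_factor P0.
by do 2!eexists; apply: gaussv_factor Prs.
Qed.

Lemma rootsum_center d e e' rs : (d%:E <= v (e - e')%R)%E ->
  rootsum e d rs = rootsum e' d rs.
Proof.
move=> ee; apply: eq_bigr => b _.
by rewrite -(minv_add vV (e' - b) ee); congr minv; ring.
Qed.

(** Both the truncated distances to the roots and the set of roots of value at least [d] depend only
    on the ball of value [d] that contains the centre. *)
Lemma gaussv_center e e' d P c t : (d%:E <= v (e - e')%R)%E ->
  gaussv v d (shift e P) c t -> gaussv v d (shift e' P) c t.
Proof.
move=> ee h.
have P0 : P != 0.
  by apply: contraTneq isT => P0; have := gaussv_neq0 vV h;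
     rewrite P0 /shift comp_poly0 eqxx.
have [rs Prs _] := prodX_factor P0.
have [-> ->] := gaussv_uniq h (gaussv_factor e d P0 Prs).
rewrite (rootsum_center _ ee).
rewrite (@eq_count _ _ (fun b => d%:E <= v (e' - b)%R)%E).
  exact: gaussv_factor.
move=> b /=; apply/idP/idP => h'.
  by rewrite -(subrK e e') -addrA; apply: (vge_add vV) => //; rewrite (v_subC vV).
by rewrite -(subrK e' e) -addrA; apply: (vge_add vV).
Qed.

Lemma v_prodX_near e d rs : (forall b, b \in rs -> (v (e - b)%R <= d%:E)%E) ->
  v (prodX rs).[e] = (rootsum e d rs)%:E.
Proof.
rewrite horner_prodX /rootsum; elim: rs => [|b rs IH] h.
  by rewrite !big_nil (v1 vV).
rewrite !big_cons (valuationM vV) EFinD IH; last first.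
  by move=> b' h'; apply: h; rewrite inE h' orbT.
by congr (_ + _)%E; apply: (minv_v vV); apply: h; rewrite mem_head.
Qed.

Lemma v_prodX_ge e d rs : ((rootsum e d rs)%:E <= v (prodX rs).[e])%E.
Proof.
rewrite horner_prodX /rootsum; elim: rs => [|b rs IH].
  by rewrite !big_nil (v1 vV).
by rewrite !big_cons; apply: (vge_mul vV) => //; apply: minv_le_v.
Qed.

Lemma v_prodX_gt e d rs b : b \in rs -> (d%:E < v (e - b)%R)%E ->
  ((rootsum e d rs)%:E < v (prodX rs).[e])%E.
Proof.
move=> brs db; rewrite horner_prodX /rootsum !(big_rem b brs) /=.
apply: (vgt_ge_mul vV).
  by apply: le_lt_trans db; rewrite lee_fin minv_le.
by rewrite -horner_prodX v_prodX_ge.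
Qed.

Lemma horner_factor P rs e : P = lead_coef P *: prodX rs ->
  P.[e] = lead_coef P * (prodX rs).[e].
Proof. by move=> h; rewrite [in LHS]h hornerZ. Qed.

(** Truncation at [d] changes no distance here, so the Gauss value is the value at the centre. *)
Lemma gaussv_near e d P : P != 0 ->
  (forall b, root P b -> (v (e - b)%R <= d%:E)%E) ->
  exists c t, v P.[e] = c%:E /\ gaussv v d (shift e P) c t.
Proof.
move=> P0 h; have [rs Prs rP] := prodX_factor P0.
do 2!eexists; split; last exact: gaussv_factor Prs.
rewrite (horner_factor _ Prs) (valuationM vV) EFinD -v_prodX_near.
  by rewrite -(vE vV) // lead_coef_eq0.
by move=> b; rewrite -rP; exact: h.
Qed.

Lemma gaussv_far e d P : P != 0 ->
  (forall b, root P b -> (v (e - b)%R < d%:E)%E) ->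
  exists2 c, v P.[e] = c%:E & gaussv v d (shift e P) c 0.
Proof.
move=> P0 h; have [rs Prs rP] := prodX_factor P0.
have [||c [t [Pc h']]] := @gaussv_near e d P _ _ => //.
  by move=> b /h /ltW.
exists c => //; have [-> t0] := gaussv_uniq h' (gaussv_factor e d P0 Prs).
have := gaussv_factor e d P0 Prs.
suff /eqP -> : count (fun b => d%:E <= v (e - b)%R)%E rs == 0%N by [].
rewrite eqn0Ngt -has_count; apply/hasPn => b; rewrite -rP => /h.
by rewrite ltNge.
Qed.

Lemma gaussv_top_gt0 e d P c t b : root P b -> (d%:E <= v (e - b)%R)%E ->
  gaussv v d (shift e P) c t -> (0 < t)%N.
Proof.
move=> Pb db h.
have P0 : P != 0.
  by apply: contraTneq isT => P0; have := gaussv_neq0 vV h;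
     rewrite P0 /shift comp_poly0 eqxx.
have [rs Prs rP] := prodX_factor P0.
have [_ ->] := gaussv_uniq h (gaussv_factor e d P0 Prs).
by rewrite -has_count; apply/hasP; exists b; rewrite // -rP.
Qed.

Lemma v_horner_near e e' P : P != 0 ->
  (forall b, root P b -> (v (e - b)%R < v (e - e')%R)%E) -> v P.[e'] = v P.[e].
Proof.
move=> P0 h; have [rs Prs rP] := prodX_factor P0.
rewrite !(horner_factor _ Prs) !(valuationM vV); congr (_ + _)%E.
have {rP}h b : b \in rs -> v (e' - b) = v (e - b).
  rewrite -rP => /h eb; have -> : e' - b = (e - b) + (e' - e) by ring.
  by rewrite (v_add_lt vV) // (v_subC vV e').
rewrite !horner_prodX; elim: rs h {Prs} => [|b rs IH] h; first by rewrite !big_nil.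
rewrite !big_cons !(valuationM vV) h ?mem_head // IH // => b' h'.
by apply: h; rewrite inE h' orbT.
Qed.

(** [P.[e']] is the constant coefficient at the centre [e'], so its value is at least the Gauss
    value, which is [v P.[e]]. *)
Lemma v_horner_le e e' d P : P != 0 -> (d%:E <= v (e - e')%R)%E ->
  (forall b, root P b -> (v (e - b)%R <= d%:E)%E) -> (v P.[e] <= v P.[e'])%E.
Proof.
move=> P0 ee /(gaussv_near P0) [c [t [-> /(gaussv_center ee) [+ _ _]]]].
by move/(_ 0%N); rewrite mul0r subr0 coef0_shift.
Qed.

Lemma rootsum_mono e d d' rs : d <= d' -> rootsum e d rs <= rootsum e d' rs.
Proof. by move=> dd; apply: ler_sum => b _; apply: (minv_mono vV). Qed.

(** The root [e] itself contributes exactly [d], which makes the growth strict. *)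
Lemma rootsum_lt e d d' rs : e \in rs -> d < d' ->
  rootsum e d rs < rootsum e d' rs.
Proof.
move=> ers dd; rewrite /rootsum !(big_rem e ers) /= subrr /minv (v0 vV) !leey.
by apply: ltr_leD => //; apply: rootsum_mono; exact: ltW.
Qed.

End Roots.

(** * Conjugate elements have the same value *)

Section Irreducible.
Variables (k K : fieldType) (iota : {rmorphism k -> K}).
Implicit Types (g h p G : {poly k}) (x : K).

Local Notation ev := (peval iota).

Lemma pevalD g h x : ev (g + h) x = ev g x + ev h x.
Proof. by rewrite /peval rmorphD hornerD. Qed.

Lemma pevalB g h x : ev (g - h) x = ev g x - ev h x.
Proof. by rewrite /peval rmorphB hornerD hornerN. Qed.

Lemma pevalM g h x : ev (g * h) x = ev g x * ev h x.
Proof. by rewrite /peval rmorphM hornerM. Qed.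

Lemma pevalX g n x : ev (g ^+ n) x = ev g x ^+ n.
Proof. by rewrite /peval rmorphXn horner_exp. Qed.

Lemma pevalZ (c : k) g x : ev (c *: g) x = iota c * ev g x.
Proof. by rewrite /peval map_polyZ hornerZ. Qed.

Lemma peval_polyXn n x : ev 'X^n x = x ^+ n.
Proof. by rewrite /peval map_polyXn hornerXn. Qed.

Lemma pevalC (c : k) x : ev c%:P x = iota c.
Proof. by rewrite /peval map_polyC hornerC. Qed.

Lemma peval0 x : ev 0 x = 0.
Proof. by rewrite /peval rmorph0 horner0. Qed.

Lemma peval1 x : ev 1 x = 1.
Proof. by rewrite /peval rmorph1 hornerC. Qed.

Lemma peval_sum (I : Type) (r : seq I) (P : pred I) (f : I -> {poly k}) x :
  ev (\sum_(i <- r | P i) f i) x = \sum_(i <- r | P i) ev (f i) x.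
Proof. by rewrite /peval rmorph_sum horner_sum. Qed.

Lemma peval_coef n g x : (size g <= n)%N ->
  ev g x = \sum_(i < n) iota g`_i * x ^+ i.
Proof.
move=> gn; rewrite /peval (@horner_coef_wide _ n) ?size_map_poly //.
by apply: eq_bigr => i _; rewrite coef_map.
Qed.

Lemma irreducible_dvd G g x : irreducible_poly G -> root (map_poly iota G) x ->
  ev g x = 0 -> G %| g.
Proof.
move=> [G1 Girr] Gx gx.
case: (boolP (coprimep G g)) => [co|nco].
  move: co; rewrite -(coprimep_map iota) => co.
  by have := coprimep_root co Gx; move: gx; rewrite /peval => ->; rewrite eqxx.
have := Girr _ nco (dvdp_gcdl G g).
by rewrite /eqp => /andP[_ /dvdp_trans]; apply; exact: dvdp_gcdr.
Qed.

Lemma irreducible_eval_neq0 G g x : irreducible_poly G ->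
  root (map_poly iota G) x -> g != 0 -> (size g < size G)%N -> ev g x != 0.
Proof.
move=> Girr Gx g0 gG; apply/eqP => /(irreducible_dvd Girr Gx) /dvdp_leq.
by move=> /(_ g0); rewrite leqNgt gG.
Qed.

Lemma peval_mod G g x : root (map_poly iota G) x -> ev (g %% G) x = ev g x.
Proof.
move=> /rootP Gx; rewrite [in RHS](divp_eq g G) pevalD pevalM.
by have -> : ev G x = 0 by []; rewrite mulr0 add0r.
Qed.

Lemma irreducible_factor g x : g != 0 -> root (map_poly iota g) x ->
  exists p, [/\ p \is monic, irreducible_poly p, root (map_poly iota p) x
              & p %| g].
Proof.
have [m] := ubnP (size g); elim: m g => // m IH g gm g0 gx.
have [irr|/existsNP[h]] := pselect (forall h, size h != 1%N -> h %| g -> h %= g).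
  have lc : lead_coef g != 0 by rewrite lead_coef_eq0.
  exists ((lead_coef g)^-1 *: g); split.
  - by rewrite monicE lead_coefZ mulVf.
  - split.
      rewrite size_scale ?invr_eq0 // ltnNge; apply/negP => /size1_polyC gC.
      move: gx; rewrite gC map_polyC rootC fmorph_eq0 => /eqP gg.
      by move: g0; rewrite gC gg eqxx.
    move=> q q1; rewrite dvdpZr ?invr_eq0 // => /(irr _ q1) qg.
    by rewrite eqp_sym (eqp_ltrans (eqp_scale _ _)) ?invr_eq0 // eqp_sym.
  - by rewrite map_polyZ rootZ // fmorph_eq0 invr_eq0.
  - by rewrite dvdpZl ?invr_eq0.
move=> /not_implyP[h1] /not_implyP[hg nhg].
have gE : g = (g %/ h) * h by rewrite divpK.
have [h0 q0] : h != 0 /\ g %/ h != 0.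
  by split; apply: contraNneq g0 => e; rewrite gE e ?mulr0 ?mul0r.
have sg : size g = (size (g %/ h)%R + size h).-1 by rewrite {1}gE size_mul.
have sh : (1 < size h)%N.
  by move: (size_poly_gt0 h) h1; rewrite h0; lia.
have sq : (1 < size (g %/ h)%R)%N.
  rewrite ltnNge; apply/negP => q1; apply: nhg; rewrite -dvdp_size_eqp // sg.
  have -> : size (g %/ h)%R = 1%N.
    by apply/eqP; rewrite eqn_leq q1 size_poly_gt0.
  by rewrite add1n.
move: gx; rewrite {1}gE rmorphM rootM => /orP[qx|hx].
  have [|||p [pm pi px pd]] := IH (g %/ h) => //.
    rewrite -ltnS (leq_trans _ gm) // ltnS sg.
    by case: (size h) sh => [|[|i]] // _; rewrite !addnS /= ltnS leq_addr.
  by exists p; split=> //; apply: dvdp_trans pd (divp_dvd hg).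
have [|||p [pm pi px pd]] := IH h => //.
  rewrite -ltnS (leq_trans _ gm) // ltnS sg.
  by case: (size _) sq => [|[|i]] // _; rewrite !addSn /= ltnS leq_addl.
by exists p; split=> //; apply: dvdp_trans pd hg.
Qed.

End Irreducible.

Section Conjugates.
Variables (k K : fieldType) (iota : {rmorphism k -> K}) (v : K -> \bar rat).
Hypothesis vV : valuation v.
Hypothesis v_complete : complete (v \o iota).
Implicit Types (g h p G : {poly k}) (x y : K).

Local Notation ev := (peval iota).

Lemma v_lower (n : nat) (f : nat -> K) :
  exists C : rat, forall i, (i < n)%N -> (C%:E <= v (f i))%E.
Proof.
elim: n => [|n [C IH]]; first by exists 0.
have [fn0|fn0] := eqVneq (f n) 0.
  exists C => i; rewrite ltnS leq_eqVlt => /orP[/eqP->|/IH //].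
  by rewrite fn0 (v0 vV) leey.
exists (Num.min C (rval v (f n))) => i; rewrite ltnS leq_eqVlt.
move=> /orP[/eqP->|/IH h]; first by rewrite (vgeP vV) // ge_min lexx orbT.
by apply: le_trans h; rewrite lee_fin ge_min lexx.
Qed.

Lemma peval_lower n x : exists D : rat, forall g (d : rat), (size g <= n)%N ->
  (forall i, (d%:E <= v (iota g`_i))%E) -> ((d + D)%:E <= v (ev g x))%E.
Proof.
have [D hD] := v_lower n (fun i => x ^+ i).
exists D => g d gn h; rewrite (peval_coef _ _ gn).
by apply: (vge_sum vV) => i _; apply: (vge_mul vV) => //; exact: hD.
Qed.

(* Any two norms on a finite dimensional space over the complete field k are
   equivalent. *)
Lemma coef_bounded G x : irreducible_poly G -> root (map_poly iota G) x ->
  forall n, (n < size G)%N -> exists C : rat, forall g (d : rat), (size g <= n)%N ->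
    (d%:E <= v (ev g x))%E -> forall i, ((d - C)%:E <= v (iota g`_i))%E.
Proof.
move=> Girr Gx; elim=> [|n IH] nG.
  exists 0 => g d; rewrite leqn0 size_poly_eq0 => /eqP -> _ i.
  by rewrite coef0 rmorph0 (v0 vV) leey.
have [C hC] := IH (ltnW nG).
have [D hD] := peval_lower n x.
(* Otherwise some sequence of monic polynomials of degree [n] has values at [x] tending to [+oo].
   The differences have degree below [n], so by induction the coefficients are Cauchy; the limit is
   monic of degree [n] and vanishes at [x], against the irreducibility of [G]. *)
have [B hB] : exists B : rat, forall g, (size g <= n.+1)%N -> g`_n = 1 ->
    (v (ev g x) < B%:E)%E.
  apply: contrapT => /forallNP hn.
  have {hn}/choice[u hu] (j : nat) : exists g,
      [/\ (size g <= n.+1)%N, g`_n = 1 & ((j%:R)%:E <= v (ev g x))%E].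
    have /existsNP[g] := hn j%:R => /not_implyP[gn /not_implyP[g1 /negP]].
    by rewrite -leNgt => h; exists g.
  have size_diff g h : (size g <= n.+1)%N -> (size h <= n.+1)%N ->
      g`_n = h`_n -> (size (g - h)%R <= n)%N.
    move=> gn hn gh; apply/leq_sizeP => j; rewrite leq_eqVlt coefB.
    move=> /orP[/eqP <-|nj]; first by rewrite gh subrr.
    by rewrite !nth_default ?subrr //; [exact: leq_trans hn nj|exact: leq_trans gn nj].
  have diff (i j N : nat) : (N <= i)%N -> (N <= j)%N -> forall t,
      ((N%:R - C)%:E <= v (iota (u i)`_t - iota (u j)`_t)%R)%E.
    move=> Ni Nj t; have [si ci vi] := hu i; have [sj cj vj] := hu j.
    rewrite -rmorphB -coefB; apply: hC.
      by apply: size_diff => //; rewrite ci cj.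
    rewrite pevalB; apply: (vge_sub vV).
      by apply: le_trans vi; rewrite lee_fin ler_nat.
    by apply: le_trans vj; rewrite lee_fin ler_nat.
  have big (M : rat) : exists N : nat, M < N%:R.
    by exists (Num.truncn M).+1; exact: Num.Theory.truncnS_gt.
  have {diff}/choice[l hl] (t : nat) : exists l : k, forall M : rat, exists N,
      forall i, (N <= i)%N -> (M%:E < v (iota ((u i)`_t - l)%R))%E.
    apply: v_complete => M; have [N hN] := big (M + C).
    exists N => i j Ni Nj /=; rewrite rmorphB.
    by apply: lt_le_trans (diff _ _ _ Ni Nj t); rewrite lte_fin; lra.
  pose g := 'X^n + \poly_(t < n) l t.
  have g1 : g`_n = 1 by rewrite coefD coefXn eqxx coef_poly ltnn addr0.
  have gn : (size g <= n.+1)%N.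
    by rewrite (leq_trans (size_polyD _ _)) // geq_max size_polyXn leqnn
      (leq_trans (size_poly _ _)).
  have g0 : g != 0 by apply: contra_eq_neq g1 => ->; rewrite coef0 eq_sym oner_eq0.
  have := irreducible_eval_neq0 Girr Gx g0 (leq_ltn_trans gn nG).
  case/eqP; apply: (v_infty vV) => M.
  have [N hN] : exists N : nat, forall i t, (N <= i)%N -> (t < n)%N ->
      ((M - D)%:E < v (iota ((u i)`_t - l t)%R))%E.
    elim: (n) => [|m [N hN]]; first by exists 0%N.
    have [N' hN'] := hl m (M - D); exists (maxn N N') => i t.
    rewrite geq_max => /andP[Ni N'i]; rewrite ltnS leq_eqVlt.
    by move=> /orP[/eqP->|tm]; [exact: hN' | exact: hN].
  have [N' hN'] := big M; pose i := maxn N N'.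
  have [si ci vi] := hu i.
  have -> : ev g x = ev (u i) x - ev (u i - g) x by rewrite pevalB subKr.
  apply: (vge_sub vV).
    apply: le_trans vi; rewrite lee_fin (le_trans (ltW hN')) // ler_nat.
    exact: leq_maxr.
  rewrite -(subrK D M); apply: hD; first by apply: size_diff; rewrite ?g1.
  move=> t; rewrite coefB coefD coefXn coef_poly.
  case: (ltngtP t n) => tn /=; last by rewrite tn ci addr0 subrr rmorph0 (v0 vV) leey.
    by rewrite add0r; apply/ltW/hN => //; exact: leq_maxl.
  by rewrite nth_default ?(leq_trans si) // addr0 subr0 rmorph0 (v0 vV) leey.
have [D1 hD1] := v_lower 1 (fun=> x ^+ n).
have {}hD1 := hD1 0%N isT.
(* [E] is the loss in removing the term of degree [n]: that term has value at least [d - B + D1] at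
   [x], and [g] has value at least [d]. *)
pose E := Num.max 0 (B - D1).
exists (Num.max B (C + E)) => g d gn dg i.
have top : ((d - B)%:E <= v (iota g`_n))%E.
  have [gn0|gn0] := eqVneq g`_n 0; first by rewrite gn0 rmorph0 (v0 vV) leey.
  have ign0 : iota g`_n != 0 by rewrite fmorph_eq0.
  have := hB ((g`_n)^-1 *: g); rewrite size_scale ?invr_eq0 // coefZ mulVf //.
  move=> /(_ gn erefl); rewrite pevalZ fmorphV => lt.
  have ne := v_le_fin vV (ltW lt).
  have gx0 : ev g x != 0 by apply: contraNneq ne => ->; rewrite mulr0.
  move: lt dg; rewrite (valuationM vV) !(vE vV) ?invr_eq0 //.
  by rewrite (rvalV vV) // lte_fin !lee_fin; lra.
case: (ltngtP i n) => [ilt|igt|->]; last 2 first.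
- by rewrite nth_default ?rmorph0 ?(v0 vV) ?leey // (leq_trans gn).
- by apply: le_trans top; rewrite lee_fin lerB // le_max lexx.
pose r := g - g`_n *: 'X^n.
have -> : g`_i = r`_i by rewrite coefB coefZ coefXn ltn_eqF // mulr0 subr0.
have rn : (size r <= n)%N.
  apply/leq_sizeP => j; rewrite leq_eqVlt coefB coefZ coefXn.
  move=> /orP[/eqP <-|nj]; first by rewrite eqxx mulr1 subrr.
  by rewrite nth_default ?(leq_trans gn) // gtn_eqF // mulr0 subrr.
apply: le_trans (hC r (d - E) rn _ i).
  by rewrite lee_fin -addrA lerD2l -opprD lerN2 le_max addrC lexx orbT.
rewrite pevalB pevalZ peval_polyXn; apply: (vge_sub vV).
  by apply: le_trans dg; rewrite lee_fin gerBl le_max lexx.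
apply: le_trans (vge_mul vV top hD1); rewrite lee_fin.
have : B - D1 <= E by rewrite le_max lexx orbT.
by lra.
Qed.

(** Powers absorb the constants: the coefficients of [g ^+ N %% G] are bounded below by [N] times
    the value of [g] at [x], up to a constant, and they bound the value of [g ^+ N] at [y]. Then [N]
    tends to infinity. *)
Lemma conjugate_le G x y : irreducible_poly G -> root (map_poly iota G) x ->
  root (map_poly iota G) y -> forall g, (v (ev g x) <= v (ev g y))%E.
Proof.
move=> Girr Gx Gy g.
have [gx0|gx0] := eqVneq (ev g x) 0.
  have /divpK <- := irreducible_dvd Girr Gx gx0.
  by rewrite (pevalM _ _ _ y) (_ : ev G y = 0) ?mulr0 ?(v0 vV) ?leey //; apply/rootP.
have [->|gy0] := eqVneq (ev g y) 0; first by rewrite (v0 vV) leey.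
rewrite !(vE vV) // lee_fin leNgt; apply/negP => lt.
have G0 : (0 < size G)%N by apply: ltn_trans Girr.1.
have Gn : ((size G).-1 < size G)%N by rewrite prednK.
have [C hC] := coef_bounded Girr Gx Gn.
have [D hD] := peval_lower (size G).-1 y.
have key N : N%:R * rval v (ev g x) - C + D <= N%:R * rval v (ev g y).
  have rN : (size (g ^+ N %% G)%R <= (size G).-1)%N.
    by rewrite -ltnS prednK // ltn_modp -size_poly_gt0.
  have := hD _ (N%:R * rval v (ev g x) - C) rN.
  rewrite (peval_mod _ Gy) pevalX (vgeP vV) ?expf_neq0 // (rvalX vV) //; apply.
  apply: hC => //; rewrite (peval_mod _ Gx) pevalX.
  by rewrite (vgeP vV) ?expf_neq0 // (rvalX vV).
pose a := rval v (ev g x) - rval v (ev g y).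
have a0 : 0 < a by rewrite subr_gt0.
have := Num.Theory.truncnS_gt ((C - D) / a); set N := _.+1.
rewrite ltr_pdivrMr // => h; have := key N; move: h; rewrite /a; lra.
Qed.

Lemma conjugate_v G x y : irreducible_poly G -> root (map_poly iota G) x ->
  root (map_poly iota G) y -> forall g, v (ev g x) = v (ev g y).
Proof.
by move=> Girr Gx Gy g; apply: le_anti; rewrite !(@conjugate_le G).
Qed.

End Conjugates.

(** * Key polynomials *)

Section AdicGauss.
Variables (K : fieldType) (v : K -> \bar rat).
Hypothesis vV : valuation v.

(* Since the tops t * s of the terms are distinct, the leading forms of terms of
   minimal value cannot cancel. *)
Lemma gaussv_adic (d : rat) (A : nat -> {poly K}) (P : {poly K})
    (c : nat -> rat) (D : rat) (t N : nat) :
  (forall s, A s != 0 -> gaussv v d (A s) (c s) 0) -> gaussv v d P D t ->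
  (0 < t)%N -> (exists2 s, (s < N)%N & A s != 0) ->
  exists s0, [/\ (s0 < N)%N, A s0 != 0,
    forall s, (s < N)%N -> A s != 0 -> c s0 + s0%:R * D <= c s + s%:R * D
    & gaussv v d (\sum_(s < N) A s * P ^+ s) (c s0 + s0%:R * D) (t * s0)].
Proof.
move=> hA hP t0.
have term s : A s != 0 -> gaussv v d (A s * P ^+ s) (c s + s%:R * D) (t * s).
  by move=> As; apply: (gaussvM vV) (hA _ As) _; apply: gaussvX.
elim: N => [[] //|N IH] ex; rewrite big_ord_recr /=.
have [AN|AN] := eqVneq (A N) 0.
  have [|s0 [s0N As0 mn gs]] := IH.
    case: ex => s; rewrite ltnS leq_eqVlt => /orP[/eqP->|sN] As.
      by rewrite AN eqxx in As.
    by exists s.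
  exists s0; split=> //; first exact: ltnW.
    move=> s; rewrite ltnS leq_eqVlt => /orP[/eqP->|sN]; last exact: mn.
    by rewrite AN eqxx.
  by rewrite AN mul0r addr0.
have [ex'|nex] := pselect (exists2 s, (s < N)%N & A s != 0).
  have [s0 [s0N As0 mn gs]] := IH ex'.
  case: (lerP (c N + N%:R * D) (c s0 + s0%:R * D)) => cmp.
    exists N; split=> //.
      move=> s; rewrite ltnS leq_eqVlt => /orP[/eqP->|sN] As //.
      exact: le_trans cmp (mn _ sN As).
    rewrite addrC; apply: (gaussvD vV (term _ AN) gs).
    move: cmp; rewrite le_eqVlt => /orP[/eqP->|]; last by left.
    by right; rewrite ltn_pmul2l.
  exists s0; split=> //; first exact: ltnW.
    move=> s; rewrite ltnS leq_eqVlt => /orP[/eqP->|sN] As; first exact: ltW.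
    exact: mn.
  by apply: (gaussvD vV gs (term _ AN)); left.
exists N; split=> //.
  move=> s; rewrite ltnS leq_eqVlt => /orP[/eqP->|sN] As //.
  by case: nex; exists s.
rewrite big1 ?add0r; first exact: term.
move=> s _; have [->|As] := eqVneq (A s) 0; first by rewrite mul0r.
by case: nex; exists s => //; exact: ltn_ord.
Qed.

End AdicGauss.

Section Closeness.
Variables (k : fieldType) (K : closedFieldType) (iota : {rmorphism k -> K}).
Variables (v : K -> \bar rat).
Hypothesis vV : valuation v.
Hypothesis v_complete : complete (v \o iota).
Implicit Types (g p F G phi : {poly k}) (x a b e : K) (c d : rat).

Local Notation ev := (peval iota).
Local Notation mp := (map_poly iota).
Local Notation gaussv := (gaussv v).
Local Notation rval := (rval v).
Local Notation rootsum := (rootsum v).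

Lemma root_peval g x : root (mp g) x = (ev g x == 0).
Proof. by []. Qed.

Lemma mp_neq0 g : (mp g != 0) = (g != 0).
Proof. by rewrite map_poly_eq0. Qed.

(** Taylor coefficients at [x] and [y] are values of the same Hasse derivatives, which lie over k,
    so they have equal values in any characteristic. This takes the place of an automorphism moving
    the centre. *)
Lemma gaussv_conj G x y : irreducible_poly G -> root (mp G) x -> root (mp G) y ->
  forall g d c t, gaussv d (shift x (mp g)) c t -> gaussv d (shift y (mp g)) c t.
Proof.
move=> Girr Gx Gy g d c t.
have e i : v (shift y (mp g))`_i = v (shift x (mp g))`_i.
  by rewrite !coef_shift !nderivn_map; apply: (conjugate_v vV v_complete Girr).
by case=> h1 h2 h3; split=> [i||i /h3]; rewrite e.
Qed.

(** [rs] lists the roots with multiplicity: the notion also serves irreducible factors of arbitrary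
    polynomials, which may be inseparable. *)
Record conjugates G (rs : seq K) : Prop := Conjugates {
  conj_irr : irreducible_poly G;
  conj_mem : forall x, root (mp G) x = (x \in rs);
  conj_prod : mp G = prodX rs;
  conj_size : size G = (size rs).+1
}.

Lemma conjugatesP G : G \is monic -> irreducible_poly G ->
  exists rs, conjugates G rs.
Proof.
move=> Gm Girr; have [|rs Grs sz] := @monic_prodX K (mp G).
  by rewrite map_monic.
exists rs; split=> //; last by rewrite -sz size_map_poly.
by move=> x; rewrite Grs root_prodX.
Qed.

Lemma conj_gt0 G rs : conjugates G rs -> (0 < size rs)%N.
Proof. by case=> -[+ _] _ _ sz; rewrite sz. Qed.

Lemma rootsum_conj G rs x y d : conjugates G rs -> x \in rs -> y \in rs ->
  rootsum x d rs = rootsum y d rs.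
Proof.
case=> Girr rt Grs _ xr yr; have := gaussv_prodX vV x d rs.
rewrite -Grs => /(gaussv_conj Girr (y := y)); rewrite !rt => /(_ xr yr) h.
by have := gaussv_prodX vV y d rs; rewrite -Grs => /(gaussv_uniq h) [].
Qed.

Lemma conj_horner G rs b : conjugates G rs -> ev G b = (prodX rs).[b].
Proof. by case=> _ _ Grs _; rewrite /peval Grs. Qed.

Lemma v_conj_near G rs x b d : conjugates G rs -> x \in rs ->
  (d%:E <= v (x - b)%R)%E -> (forall y, y \in rs -> (v (y - b)%R <= d%:E)%E) ->
  v (ev G b) = (rootsum x d rs)%:E.
Proof.
move=> Grs xr xb h; rewrite (conj_horner _ Grs) (v_prodX_near vV (d := d)).
  by congr (_%:E); apply: (rootsum_center vV); rewrite (v_subC vV).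
by move=> y yr; rewrite (v_subC vV); exact: h.
Qed.

Lemma closest_conj G rs b : conjugates G rs -> ev G b != 0 ->
  exists x d, [/\ x \in rs, v (x - b) = d%:E
                & forall y, y \in rs -> (v (y - b)%R <= d%:E)%E].
Proof.
move=> Grs; rewrite (conj_horner _ Grs) horner_prodX.
move: (conj_gt0 Grs) => {Grs}; elim: rs => // x rs IH _.
rewrite big_cons mulf_eq0 negb_or => /andP[bx brs].
have xb : v (x - b) = (rval (x - b))%:E.
  by apply: (vE vV); rewrite -oppr_eq0 opprB.
have [rs0|rs0] := posnP (size rs).
  exists x, (rval (x - b)); split=> //; first exact: mem_head.
  by move=> y; rewrite (size0nil rs0) inE => /eqP ->; rewrite xb.
have [y [d [yr yb h]]] := IH rs0 brs.
case: (lerP d (rval (x - b))) => cmp.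
  exists x, (rval (x - b)); split=> //; first exact: mem_head.
  move=> z; rewrite inE => /orP[/eqP->|/h zb]; first by rewrite xb.
  by apply: le_trans zb _; rewrite lee_fin.
exists y, d; split=> //; first by rewrite inE yr orbT.
by move=> z; rewrite inE => /orP[/eqP->|/h //]; rewrite xb lee_fin ltW.
Qed.

(** For a root [x] closest to [b], each [v (y - b)] is [v (x - y)] truncated at [d]; thus the value
    at [b] becomes a Gauss value centred at a root of [G]. *)
Lemma closest_conj_eval G rs b : conjugates G rs -> ev G b != 0 ->
  exists d, [/\ forall x, x \in rs -> rval (ev G b) = rootsum x d rs,
                exists2 x, x \in rs & v (x - b) = d%:E
              & forall y, y \in rs -> (v (y - b)%R <= d%:E)%E].
Proof.
move=> Grs Gb; have [x [d [xr xb h]]] := closest_conj Grs Gb.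
exists d; split=> //; last by exists x.
move=> y yr; rewrite (rootsum_conj _ Grs yr xr); apply: rvalE.
by apply: v_conj_near => //; rewrite xb.
Qed.

Lemma sum_seq_const (T : eqType) (r : seq T) (f : T -> rat) c :
  (forall y, y \in r -> f y = c) -> \sum_(y <- r) f y = (size r)%:R * c.
Proof.
elim: r => [|y r IH] h; first by rewrite big_nil mul0r.
rewrite big_cons h ?mem_head // IH => [|z zr]; last first.
  by apply: h; rewrite inE zr orbT.
by rewrite /= -natr1; ring.
Qed.

Lemma rval_prodX_eval (rs : seq K) b : b \notin rs ->
  rval (prodX rs).[b] = \sum_(x <- rs) rval (x - b).
Proof.
rewrite horner_prodX; elim: rs => [|x rs IH]; first by rewrite !big_nil (rval1 vV).
rewrite inE negb_or => /andP[bx brs]; rewrite !big_cons (rvalM vV) ?subr_eq0 //.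
  by rewrite IH // /rval (v_subC vV).
by rewrite -horner_prodX; have := root_prodX rs b; rewrite (negbTE brs) => /negbT.
Qed.

(* The resultant of G and p, computed in two ways. *)
Lemma v_resultant G rs p bs x : conjugates G rs -> x \in rs ->
  mp p = prodX bs -> (forall b, b \in bs -> b \notin rs) ->
  (size rs)%:R * rval (ev p x) = \sum_(b <- bs) rval (ev G b).
Proof.
move=> Grs xr pbs dis.
have dis' y : y \in rs -> y \notin bs by apply: contraTN; exact: dis.
transitivity (\sum_(y <- rs) rval (ev p y)).
  symmetry; apply: sum_seq_const => y yr; congr fine.
  by apply: (conjugate_v vV v_complete (conj_irr Grs)); rewrite (conj_mem Grs).
transitivity (\sum_(y <- rs) \sum_(b <- bs) rval (b - y)).
  rewrite big_seq [RHS]big_seq; apply: eq_bigr => y yr.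
  by rewrite /peval pbs rval_prodX_eval // dis'.
rewrite exchange_big /= big_seq [RHS]big_seq; apply: eq_bigr => b br.
rewrite (conj_horner _ Grs) rval_prodX_eval ?dis //.
by apply: eq_bigr => y _; rewrite /rval (v_subC vV).
Qed.

Lemma conj_notin G rs p b : conjugates G rs -> p != 0 -> (size p < size G)%N ->
  root (mp p) b -> b \notin rs.
Proof.
move=> Grs p0 pG pb; rewrite -(conj_mem Grs); apply/negP => Gb.
have := irreducible_eval_neq0 (conj_irr Grs) Gb p0 pG.
by rewrite -root_peval pb.
Qed.

Lemma conj_eval_neq0 G rs p b : conjugates G rs -> p != 0 ->
  (size p < size G)%N -> root (mp p) b -> ev G b != 0.
Proof.
by move=> Grs p0 pG pb; rewrite -root_peval (conj_mem Grs) (conj_notin Grs p0 pG pb).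
Qed.

Lemma v_resultant_irr G rs p b x : conjugates G rs -> x \in rs ->
  p \is monic -> irreducible_poly p -> (size p < size G)%N -> root (mp p) b ->
  (size rs)%:R * rval (ev p x) = (size p).-1%:R * rval (ev G b).
Proof.
move=> Grs xr pm pirr pG pb; have [bs pbs] := conjugatesP pm pirr.
have p0 := monic_neq0 pm.
rewrite (v_resultant Grs xr (conj_prod pbs)); last first.
  by move=> b'; rewrite -(conj_mem pbs); exact: (conj_notin Grs p0 pG).
rewrite (conj_size pbs) /=; apply: sum_seq_const => b'; rewrite -(conj_mem pbs) => pb'.
by congr fine; apply: (conjugate_v vV v_complete pirr).
Qed.

(** As [m] bounds sizes, it is an exclusive bound on degrees. Below it, Gauss values at radius [d]
    are values at the roots of [G]; with [far], the tops are moreover 0. *)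
Definition near G d (m : nat) := forall p b x, p != 0 -> (size p <= m)%N ->
  root (mp p) b -> root (mp G) x -> (v (x - b)%R <= d%:E)%E.

Definition far G d (m : nat) := forall p b x, p != 0 -> (size p <= m)%N ->
  root (mp p) b -> root (mp G) x -> (v (x - b)%R < d%:E)%E.

Lemma near_gaussv G d m g x : near G d m -> g != 0 -> (size g <= m)%N ->
  root (mp G) x ->
  exists2 t, v (ev g x) = (rval (ev g x))%:E
           & gaussv d (shift x (mp g)) (rval (ev g x)) t.
Proof.
move=> nr g0 gm Gx.
have [||c [t [gc h]]] := @gaussv_near K v vV x d (mp g); first by rewrite mp_neq0.
  by move=> b gb; exact: nr gb Gx.
by exists t; rewrite /peval (rvalE gc).
Qed.

Lemma far_gaussv G d m g x : far G d m -> g != 0 -> (size g <= m)%N ->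
  root (mp G) x -> gaussv d (shift x (mp g)) (rval (ev g x)) 0.
Proof.
move=> nr g0 gm Gx.
have [||c gc h] := @gaussv_far K v vV x d (mp g); first by rewrite mp_neq0.
  by move=> b gb; exact: nr gb Gx.
by rewrite /peval (rvalE gc).
Qed.

(** The two size bounds differ by one: [d] is the closest approach in degrees up to that of [phi],
    and it is not reached in smaller degree. *)
Record key_poly G d phi : Prop := KeyPoly {
  key_monic : phi \is monic;
  key_irr : irreducible_poly phi;
  key_size : (size phi < size G)%N;
  key_far : far G d (size phi).-1;
  key_near : near G d (size phi);
  key_root : exists a x, [/\ root (mp phi) a, root (mp G) x & v (x - a) = d%:E]
}.

Section KeyPolynomial.
Variables (G : {poly k}) (rs : seq K) (d : rat) (phi : {poly k}) (x : K).
Hypothesis Grs : conjugates G rs.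
Hypothesis key : key_poly G d phi.
Hypothesis xrs : x \in rs.

Local Notation a_ g s := (adic_coef phi g s).
Local Notation D := (rval (ev phi x)).
Local Notation n := (size rs).
Local Notation m := (size phi).-1.

Let Gx : root (mp G) x. Proof. by rewrite (conj_mem Grs). Qed.
Let phi0 : phi != 0. Proof. exact: monic_neq0 (key_monic key). Qed.
Let phi1 : (1 < size phi)%N. Proof. exact: (key_irr key).1. Qed.

Lemma key_gaussv : exists2 t, (0 < t)%N & gaussv d (shift x (mp phi)) D t.
Proof.
have [t _ h] := near_gaussv (key_near key) phi0 (leqnn _) Gx.
exists t => //; have [a [y [pa Gy ya]]] := key_root key.
apply: (gaussv_top_gt0 vV pa _ (gaussv_conj (conj_irr Grs) Gx Gy h)).
by rewrite ya.
Qed.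

Lemma adic_size g s : (size (a_ g s) <= m)%N.
Proof. by rewrite -ltnS prednK ?size_adic_coef // ltnW. Qed.

Lemma shift_mp_sum g : shift x (mp g) =
  \sum_(s < size g) shift x (mp (a_ g s)) * shift x (mp phi) ^+ s.
Proof.
rewrite {1}(adic_expansion g phi1) rmorph_sum /shift linear_sum /=.
by apply: eq_bigr => s _; rewrite rmorphM rmorphXn comp_polyM rmorphXn.
Qed.

Lemma shift_mp_eq0 g : (shift x (mp g) == 0) = (g == 0).
Proof. by rewrite comp_poly2_eq0 ?size_XaddC // map_poly_eq0. Qed.

(** MacLane's formula, with values at [x] in place of the previous valuation: the coefficients have
    top 0 by [far] and [phi] has positive top, so the terms cannot cancel. *)
Lemma key_adic g c t : g != 0 -> gaussv d (shift x (mp g)) c t ->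
  (forall s, a_ g s != 0 -> c <= rval (ev (a_ g s) x) + s%:R * D) /\
  exists2 s, (s < size g)%N & a_ g s != 0 /\ c = rval (ev (a_ g s) x) + s%:R * D.
Proof.
move=> g0 gc; have [u u0 hphi] := key_gaussv.
have small s : (size g <= s)%N -> a_ g s = 0.
  move=> gs; rewrite /adic_coef divp_small ?mod0p //.
  rewrite -[X in (_ < X)%N]prednK ?size_poly_gt0 ?expf_neq0 // ltnS size_exp.
  by apply: leq_trans gs _; rewrite leq_pmull // -subn1 subn_gt0.
have [||||s0 [s0N As0 mn h]] := @gaussv_adic K v vV d
    (fun s => shift x (mp (a_ g s))) (shift x (mp phi))
    (fun s => rval (ev (a_ g s) x)) D u (size g).
- move=> s; rewrite shift_mp_eq0 => As.
  exact: (far_gaussv (key_far key) As (adic_size _ _) Gx).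
- exact: hphi.
- by [].
- apply: contrapT => /forall2NP h; case/eqP: g0; rewrite (adic_expansion g phi1).
  apply: big1 => s _; have [/(_ (ltn_ord s)) //|/negP] := h s.
  by rewrite negbK shift_mp_eq0 => /eqP ->; rewrite mul0r.
move: h; rewrite -shift_mp_sum => /(gaussv_uniq gc)[-> _].
split; last by exists s0 => //; split => //; rewrite shift_mp_eq0 in As0.
move=> s As; apply: mn; last by rewrite shift_mp_eq0.
by rewrite ltnNge; apply: contraNN As => /small ->.
Qed.

Lemma key_eval a : root (mp phi) a ->
  rval (ev G a) = rootsum x d rs /\ n%:R * D = m%:R * rootsum x d rs.
Proof.
move=> pa.
have [a' [y [pa' Gy ya]]] := key_root key.
have e : rval (ev G a') = rootsum x d rs.
  rewrite (rootsum_conj _ Grs xrs (y := y)); last by rewrite -(conj_mem Grs).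
  apply: rvalE; apply: (v_conj_near Grs); first by rewrite -(conj_mem Grs).
    by rewrite ya.
  move=> z; rewrite -(conj_mem Grs) => Gz.
  exact: (key_near key phi0 (leqnn _) pa' Gz).
have e2 := v_resultant_irr Grs xrs (key_monic key) (key_irr key) (key_size key) pa'.
rewrite e2 e; split=> //; rewrite -e; congr fine.
exact: (conjugate_v vV v_complete (key_irr key)).
Qed.

(** By the resultant, the slope of [g] averages Gauss values of [G] at radii below [d], whereas that
    of [phi] is the Gauss value at [d], all divided by [n]. Reducible [g] must be allowed: the lemma
    is applied to the leading adic coefficient of [G]. *)
Lemma far_slope g : g \is monic -> (1 < size g)%N -> (size g <= m)%N ->
  m%:R * rval (ev g x) < (size g).-1%:R * D.
Proof.
move=> gm g1 gs.
have [bs gbs sbs] : exists2 bs, mp g = prodX bs & size (mp g) = (size bs).+1.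
  by apply: monic_prodX; rewrite map_monic.
have g0 := monic_neq0 gm.
have gG : (size g < size G)%N.
  by apply: leq_ltn_trans gs _; rewrite (leq_ltn_trans (leq_pred _)) // (key_size key).
have rootb b : b \in bs -> root (mp g) b by rewrite gbs root_prodX.
have := v_resultant Grs xrs gbs (fun b br => conj_notin Grs g0 gG (rootb b br)).
have lt b : b \in bs -> rval (ev G b) < rootsum x d rs.
  move=> br; have [d' [h1 [y yr yb] _]] :=
    closest_conj_eval Grs (conj_eval_neq0 Grs g0 gG (rootb b br)).
  rewrite (h1 _ xrs); apply: (rootsum_lt vV) => //.
  have := key_far key g0 gs (rootb b br) (x := y).
  by rewrite (conj_mem Grs) yb lte_fin => /(_ yr).
have : \sum_(b <- bs) rval (ev G b) < (size bs)%:R * rootsum x d rs.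
  move: sbs; rewrite size_map_poly; case: (bs) lt g1 => [|b bs'] lt.
    by move=> + h; rewrite h.
  move=> _ _; rewrite -(@sum_seq_const _ (b :: bs') (fun=> rootsum x d rs)) //.
  rewrite !big_cons; apply: ltr_leD; first exact/lt/mem_head.
  rewrite [X in X <= _]big_seq [X in _ <= X]big_seq; apply: ler_sum => b' b'r.
  by apply/ltW/lt; rewrite inE b'r orbT.
move=> h1 h2; rewrite -h2 in h1.
have [a [y [pa _ _]]] := key_root key; have [_ e] := key_eval pa.
move: sbs; rewrite size_map_poly => ->; rewrite /=.
have n0 : 0 < n%:R :> rat by rewrite ltr0n (conj_gt0 Grs).
rewrite -(ltr_pM2l n0) mulrCA [X in _ < X]mulrCA e mulrA [X in _ < X]mulrCA.
by rewrite -mulrA ltr_pM2l // ltr0n -subn1 subn_gt0.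
Qed.

Lemma adic_coef0_eval a : root (mp phi) a ->
  ev (a_ G 0) a = ev G a.
Proof. by move=> pa; rewrite /adic_coef expr0 divp1 (peval_mod _ pa). Qed.

(* The two end points of the Newton polygon of G with respect to phi. *)
Lemma key_endpoints : G \is monic ->
  a_ G 0 != 0 /\ rval (ev (a_ G 0) x) = rootsum x d rs /\
  [/\ (0 < n %/ m)%N, a_ G (n %/ m) = 1, (n %/ m)%:R * D = rootsum x d rs
    & forall s, (n %/ m < s)%N -> a_ G s = 0].
Proof.
move=> Gm.
have [a [y [pa Gy ya]]] := key_root key.
have [e1 e2] := key_eval pa.
have Ga := adic_coef0_eval pa.
have a00 : a_ G 0 != 0.
  apply: contraNneq (conj_eval_neq0 Grs phi0 (key_size key) pa) => a0.
  by rewrite -Ga a0 peval0.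
(* At the root [a] of [phi] the coefficient [a_ G 0] equals [G]. Its roots are farther from [y] than
   [a] is, so it has the same value at [a] and at [y], hence at [x]. *)
have E0 : rval (ev (a_ G 0) x) = rootsum x d rs.
  rewrite -e1 -Ga /rval; congr fine.
  rewrite (conjugate_v vV v_complete (conj_irr Grs) Gx Gy) /peval.
  symmetry; apply: (v_horner_near vV); first by rewrite mp_neq0.
  move=> b br; rewrite ya; exact: (key_far key a00 (adic_size _ _) br Gy).
have sG := conj_size Grs.
have m0 : (0 < m)%N by rewrite -subn1 subn_gt0.
have mn : (m <= n)%N.
  by have := key_size key; rewrite sG ltnS => h; apply: leq_trans (leq_pred _) h.
have S0 : (0 < n %/ m)%N by rewrite divn_gt0.
set S := (n %/ m)%N in S0 *.
have smul s : size (phi ^+ s) = (m * s).+1.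
  by rewrite -[LHS]prednK ?size_poly_gt0 ?expf_neq0 // size_exp.
have big s : (S < s)%N -> a_ G s = 0.
  move=> Ss; rewrite /adic_coef divp_small ?mod0p // sG smul ltnS.
  by rewrite mulnC -ltn_divLR.
pose q := G %/ phi ^+ S.
have pSm : phi ^+ S \is monic by rewrite monic_exp // (key_monic key).
have sq : size q = (n %% m).+1.
  rewrite size_divp ?expf_neq0 // sG smul /= subSn; last by rewrite mulnC leq_trunc_div.
  by rewrite {1}(divn_eq n m) mulnC addnC addnK.
have qm : q \is monic.
  rewrite monicE; have /monicP := Gm; rewrite {1}(divp_eq G (phi ^+ S)) -/q.
  rewrite lead_coefDl ?lead_coef_Mmonic //; first by move=> ->.
  rewrite (@leq_trans (size (phi ^+ S))) ?ltn_modp ?expf_neq0 //.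
  have q0 : q != 0 by rewrite -size_poly_gt0 sq.
  by rewrite size_Mmonic // sq addSn /= leq_addl.
have aS : a_ G S = q.
  by rewrite /adic_coef modp_small // sq -[X in (_ < X)%N]prednK ?ltnS ?ltn_pmod // ltnW.
have GG0 : mp G != 0 by rewrite mp_neq0 monic_neq0.
have [c [t gc]] := gaussv_exists vV x d GG0.
have cE : c = rootsum x d rs.
  have := gaussv_prodX vV x d rs; rewrite -(conj_prod Grs).
  by move=> /(gaussv_uniq gc)[].
have [/(_ S) + _] := key_adic (monic_neq0 Gm) gc.
rewrite aS monic_neq0 // => /(_ isT) cq.
have m0' : 0 < m%:R :> rat by rewrite ltr0n.
have nE : n%:R = (n %% m)%:R + S%:R * m%:R :> rat.
  by rewrite {1}(divn_eq n m) natrD natrM addrC.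
(* Otherwise [q] is monic of positive degree below [m], so [far_slope] puts the last term
   [q * phi ^+ S] below the minimum [c], which is [n * D / m]. *)
have r0 : (n %% m = 0)%N.
  apply: contrapT => /eqP; rewrite -lt0n => r0.
  have := far_slope qm; rewrite sq ltnS ltn_pmod // => /(_ r0 isT) /=.
  have : m%:R * c <= m%:R * (rval (ev q x) + S%:R * D) by rewrite ler_pM2l.
  by rewrite cE -e2 nE; lra.
split=> //; split=> //; split=> //.
  move: sq; rewrite r0 => /eqP/size_poly1P[q0 _ qC].
  by move/monicP: qm; rewrite qC lead_coefC => ->.
apply: (mulfI (lt0r_neq0 m0')); rewrite -e2 nE r0 add0r; ring.
Qed.
End KeyPolynomial.

End Closeness.

(** * Newton polygons and MacLane valuations *)

Section NewtonSlope.

(** A half-plane containing [A] contains its hull; the facts on hulls below reduce to such linear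
    inequalities. *)
Lemma hull_ge (A : set (rat * rat)) (a b c : rat) (P : rat * rat) :
  (forall Q, A Q -> c <= a * Q.1 + b * Q.2) -> convex_hull A P ->
  c <= a * P.1 + b * P.2.
Proof.
move=> h [n [q [e [Aq e0 e1 -> ->]]]].
rewrite !mulr_sumr -big_split /= -[c]mulr1 -e1 mulr_sumr.
apply: ler_sum => i _; have := h _ (Aq i); have := e0 i.
by move=> e0i /(ler_wpM2l e0i); lra.
Qed.

Lemma hull_eq (A : set (rat * rat)) (a b c : rat) (P : rat * rat) :
  (forall Q, A Q -> a * Q.1 + b * Q.2 = c) -> convex_hull A P ->
  a * P.1 + b * P.2 = c.
Proof.
move=> h hP; apply: le_anti; apply/andP; split; last first.
  by apply: hull_ge hP => Q /h ->.
rewrite -lerN2; suff : - c <= (- a) * P.1 + (- b) * P.2 by lra.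
by apply: hull_ge hP => Q /h <-; lra.
Qed.

Lemma hull_sub (A B : set (rat * rat)) : A `<=` B -> convex_hull A `<=` convex_hull B.
Proof.
by move=> AB P [n [q [e [Aq e0 e1 p1 p2]]]]; exists n, q, e; split=> // i; exact: AB.
Qed.

Lemma hull_mem (A : set (rat * rat)) P : A P -> convex_hull A P.
Proof.
move=> AP; exists 1%N, (fun=> P), (fun=> 1).
by split=> //; rewrite big_ord1 // mul1r.
Qed.

Lemma hull_segment (P Q R : rat * rat) : P.1 < Q.1 -> P.1 <= R.1 <= Q.1 ->
  (R.2 - P.2) * (Q.1 - P.1) = (Q.2 - P.2) * (R.1 - P.1) ->
  convex_hull [set P; Q] R.
Proof.
move=> PQ /andP[PR RQ] eR; have d0 : 0 < Q.1 - P.1 by rewrite subr_gt0.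
have dn0 := lt0r_neq0 d0.
pose c := (R.1 - P.1) / (Q.1 - P.1).
have cE : c * (Q.1 - P.1) = R.1 - P.1 by rewrite divfK.
have c0 : 0 <= c by rewrite divr_ge0 ?subr_ge0 // ltW.
have c1 : c <= 1 by rewrite ler_pdivrMr // mul1r lerB.
have cE2 : R.2 - P.2 = c * (Q.2 - P.2).
  by apply: (mulIf dn0); rewrite eR -cE; ring.
exists 2%N, (fun i => if i == 0 then P else Q), (fun i => if i == 0 then 1 - c else c).
split=> [i|i|||].
- by case: ifP => _; [left|right].
- by case: ifP => _; rewrite // subr_ge0.
- by rewrite !big_ord_recl big_ord0 /=; lra.
- by rewrite !big_ord_recl big_ord0 /=; lra.
- by rewrite !big_ord_recl big_ord0 /=; lra.
Qed.

(** Makes the choice by [xget] in [newton_slope] unambiguous: two points of [A] with distinct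
    abscissas determine the slope. *)
Lemma slope_uniq (A : set (rat * rat)) a b :
  segment_of_slope A a -> segment_of_slope A b -> a = b.
Proof.
move=> [P [Q [PQ AE sl]]] [P' [Q' [PQ' AE' sl']]].
have line R : A R -> - a * R.1 + 1 * R.2 = P.2 - a * P.1.
  by rewrite AE; apply: hull_eq => S [->|->]; lra.
have lP : A P' by rewrite AE'; apply: hull_mem; left.
have lQ : A Q' by rewrite AE'; apply: hull_mem; right.
have e : (a - b) * (Q'.1 - P'.1) = 0.
  by have := line _ lP; have := line _ lQ; lra.
move/eqP: e; rewrite mulf_eq0 !subr_eq0 => /orP[/eqP //|/eqP e].
by rewrite e ltxx in PQ'.
Qed.

(** Every point lies on or above the chord joining the two ends, so the lower hull is that chord.
    Zero coefficients have infinite ordinate and give no point. *)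
Lemma newton_slope_eq (k : fieldType) (w : {poly k} -> \bar rat)
    (phi G : {poly k}) (l y0 : rat) (S : nat) :
  let pt s := (w (adic_coef phi G s) + s%:R%:E * w phi)%E in
  (0 < S)%N -> pt 0%N = y0%:E -> pt S = (y0 - l * S%:R)%:E ->
  (forall s y, pt s = y%:E -> (s <= S)%N /\ y0 - l * s%:R <= y) ->
  newton_slope w phi G = l.
Proof.
move=> pt S0 p0 pS h; apply: xget_subset1; last first.
  move=> a b /= /slope_uniq ha /ha; exact: oppr_inj.
have S0' : 0 < S%:R :> rat by rewrite ltr0n.
exists (0, y0), (S%:R, y0 - l * S%:R); split=> //=; last by lra.
set B := convex_hull [set _; _].
have BE R : B R <-> 0 <= R.1 <= S%:R /\ R.2 = y0 - l * R.1.
  split=> [hR|[Rb RE]]; last by apply: hull_segment => //=; rewrite RE; lra.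
  have a1 : 0 <= 1 * R.1 + 0 * R.2.
    by apply: hull_ge hR => Q [->|->] /=; lra.
  have a2 : - S%:R <= - 1 * R.1 + 0 * R.2.
    by apply: hull_ge hR => Q [->|->] /=; lra.
  have a3 : l * R.1 + 1 * R.2 = y0.
    by apply: hull_eq hR => Q [->|->] /=; lra.
  by split; [apply/andP; split|]; lra.
pose A := newton_points w phi G.
have AA Q : A Q -> 0 <= Q.1 <= S%:R /\ y0 - l * Q.1 <= Q.2.
  by case=> s -> /h [sS]; rewrite ler0n ler_nat sS.
have BA : B `<=` convex_hull A.
  apply: hull_sub => Q [->|->]; [exists 0%N|exists S] => //=.
have hA R : convex_hull A R -> 0 <= R.1 <= S%:R /\ y0 - l * R.1 <= R.2.
  move=> hR.
  have a1 : 0 <= 1 * R.1 + 0 * R.2.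
    by apply: hull_ge hR => Q /AA [/andP[]]; lra.
  have a2 : - S%:R <= - 1 * R.1 + 0 * R.2.
    by apply: hull_ge hR => Q /AA [/andP[]]; lra.
  have a3 : y0 <= l * R.1 + 1 * R.2.
    by apply: hull_ge hR => Q /AA []; lra.
  by split; [apply/andP; split|]; lra.
apply/seteqP; split=> R.
  move=> [hR mn]; have [Rb Rl] := hA _ hR; apply/BE; split=> //.
  apply: le_anti; rewrite Rl andbT; apply: mn; apply: BA; exact/BE.
move=> BR; split; first exact: BA.
move=> y /hA /= [_]; by have [_ ->] := (BE R).1 BR.
Qed.

End NewtonSlope.

Lemma bigmin_eq n (f : 'I_n -> \bar rat) (c : \bar rat) :
  (forall i, (c <= f i)%E) -> (exists i, f i = c) ->
  \big[Order.min/+oo%E]_(i < n) f i = c.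
Proof.
move=> cf [j jc]; apply: le_anti; apply/andP; split; last first.
  elim/big_ind: _ => [|x y cx cy|//]; first exact: leey.
  by rewrite le_min cx cy.
rewrite -jc; have : j \in index_enum 'I_n by rewrite mem_index_enum.
elim: (index_enum _) => // i r IH; rewrite inE big_cons ge_min.
by move=> /orP[/eqP<-|/IH ->]; rewrite ?lexx ?orbT.
Qed.

(** * Value groups and the ramification index *)

Section ValueGroup.
Variables (k K : fieldType) (iota : {rmorphism k -> K}) (v : K -> \bar rat).
Hypothesis vV : valuation v.
Hypothesis v_normal : value_group v (base_field iota) = range (intr : int -> rat).
Variable (x : K).
Implicit Types (g h : {poly k}) (r s : rat).

Local Notation ev := (peval iota).
Local Notation VG := (value_group v (adjoin iota x)).

Lemma adjoin_peval g : adjoin iota x (ev g x).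
Proof. by exists g, 1; rewrite peval1 oner_eq0 divr1. Qed.

Lemma adjoinM y z : adjoin iota x y -> adjoin iota x z -> adjoin iota x (y * z).
Proof.
move=> [g [h [h0 ->]]] [g' [h' [h0' ->]]]; exists (g * g'), (h * h').
by rewrite !pevalM mulf_neq0 // mulf_div.
Qed.

Lemma adjoinV y : adjoin iota x y -> adjoin iota x y^-1.
Proof.
move=> [g [h [h0 ->]]]; have [g0|g0] := eqVneq (ev g x) 0.
  by rewrite g0 mul0r invr0 -(peval0 iota x); exact: adjoin_peval.
by exists h, g; rewrite invf_div.
Qed.

Lemma value_group_peval g : ev g x != 0 -> VG (rval v (ev g x)).
Proof. by move=> g0; exists (ev g x); [exact: adjoin_peval | exact: (vE vV)]. Qed.

Lemma value_groupD r s : VG r -> VG s -> VG (r + s).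
Proof.
move=> [y Ly yr] [z Lz zs]; exists (y * z); first exact: adjoinM.
exact: (veq_mul vV).
Qed.

Lemma value_groupN r : VG r -> VG (- r).
Proof.
move=> [y Ly yr]; exists y^-1; first exact: adjoinV.
have y0 := v_fin_neq0 vV yr.
by rewrite (vE vV) ?invr_eq0 // (rvalV vV) // (rvalE yr).
Qed.

Lemma value_groupMz r (z : int) : VG r -> VG (z%:~R * r).
Proof.
move=> Vr; have nat n : VG (n%:R * r).
  elim: n => [|n IH]; last by rewrite -natr1 mulrDl mul1r; exact: value_groupD.
  rewrite mul0r; exists 1; last exact: v1 vV.
  by rewrite -(peval1 iota x); exact: adjoin_peval.
case: z => n; first exact: nat.
by rewrite NegzE mulrNz mulNr; apply: value_groupN; exact: nat.
Qed.

Lemma base_value (a : k) r : v (iota a) = r%:E -> exists z : int, r = z%:~R.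
Proof.
move=> ar; have : value_group v (base_field iota) r by exists (iota a) => //; exists a.
by rewrite v_normal => -[z _ <-]; exists z.
Qed.

Lemma value_group1 : VG 1.
Proof.
have : value_group v (base_field iota) 1 by rewrite v_normal; exists 1.
move=> [_ [a _ <-] va]; exists (iota a) => //.
by rewrite -(pevalC iota a x); exact: adjoin_peval.
Qed.

Lemma ramification_indexE (E : nat) : (0 < E)%N ->
  (forall r, VG r <-> exists z : int, E%:R * r = z%:~R) ->
  ramification_index iota v (adjoin iota x) = E.
Proof.
move=> E0 VE; rewrite /ramification_index v_normal.
have E0' : 0 < E%:R :> rat by rewrite ltr0n.
have En0 := lt0r_neq0 E0'.
set coset := fun r : rat => _.
have cosetP r s : coset r = coset s <-> exists z : int, s - r = z%:~R.
  split=> [e|[z ez]].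
    have : coset s s by rewrite /coset /= subrr; exists 0.
    by rewrite -e => -[z _ <-]; exists z.
  apply/seteqP; split=> u [y _ yu]; [exists (y - z)|exists (y + z)] => //;
    by rewrite ?rmorphB ?rmorphD /= yu -ez; ring.
apply: xget_subset1; last first.
  move=> e e' /= he he'; apply/card_eq_II.
  by apply: card_eq_trans he'; rewrite card_eq_sym.
(* The value group is (1/E)Z, and each of its cosets modulo Z contains [i / E] for exactly one
   [i < E]. *)
suff -> : (coset @` VG)%classic =
    ((fun i : nat => coset (i%:R / E%:R)) @` `I_E)%classic.
  apply: inj_card_eq => i j /set_mem /= iE /set_mem /= jE /cosetP[z].
  move=> /(congr1 (fun u => E%:R * u)).
  have -> : E%:R * (j%:R / E%:R - i%:R / E%:R) = (j%:Z - i%:Z)%:~R :> rat.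
    by rewrite mulrBr !(mulrC E%:R) !divfK // rmorphB.
  rewrite -[E%:R]/(E%:Z%:~R) -rmorphM => /(@intr_inj rat) ez.
  have z1 : (z < 1)%R by nia.
  have z2 : (-1 < z)%R by nia.
  have z0 : z = 0 by lia.
  by move: ez; rewrite z0; lia.
apply/seteqP; split=> [_ [r Vr <-]|_ [i iE <-]]; last first.
  exists (i%:R / E%:R) => //; apply/VE; exists i%:Z.
  by rewrite mulrC divfK.
have [z ez] := (VE r).1 Vr.
have EZ0 : E%:Z != 0 by lia.
exists `|(z %% E%:Z)%Z|%N.
  by rewrite /=; have := modz_ge0 z EZ0; have := ltz_pmod z (d := E%:Z); lia.
apply/cosetP; exists (z %/ E%:Z)%Z.
apply: (mulfI En0); rewrite mulrBr ez mulrCA divff // mulr1.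
have -> : `|(z %% E%:Z)%Z|%N%:R = ((z %% E%:Z)%Z)%:~R :> rat.
  by rewrite -[LHS]/((`|(z %% E%:Z)%Z|%N : int)%:~R) gez0_abs // modz_ge0.
rewrite {1}(divz_eq z E%:Z) rmorphD rmorphM /=.
by rewrite addrK mulrC.
Qed.

End ValueGroup.

(** * MacLane valuations along a chain of key polynomials *)

Section MacLane.
Variables (k : fieldType) (K : closedFieldType) (iota : {rmorphism k -> K}).
Variables (v : K -> \bar rat).
Hypothesis vV : valuation v.
Hypothesis v_complete : complete (v \o iota).
Hypothesis v_normal : value_group v (base_field iota) = range (intr : int -> rat).
Implicit Types (g p F G phi : {poly k}) (a b e : K) (c d : rat).

Local Notation ev := (peval iota).
Local Notation mp := (map_poly iota).
Local Notation gaussv := (gaussv v).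
Local Notation rval := (rval v).
Local Notation rootsum := (rootsum v).

(** The trace of a frame in terms of distances between roots only, with [d] the current and [dr] the
    final distance; in this form it passes to polynomials whose roots are close to those of [G]. *)
Inductive chain G : rat -> seq {poly k} -> rat -> Prop :=
| ChainNil d : near iota v G d (size G).-1 -> chain G d [::] d
| ChainCons d d' phi s dr : key_poly iota v G d' phi ->
    near iota v G d (size phi).-1 -> chain G d' s dr -> chain G d (phi :: s) dr.

(** [w] is [E] times the Gauss valuation at [x]. [rep_int] and [rep_group] bound the ramification
    index from above and below; [rep0] is separate because the zero polynomial has no Gauss
    value. *)
Record represents x (w : {poly k} -> \bar rat) (E : nat) d : Prop := Represents {
  rep_gt0 : (0 < E)%N;
  rep0 : w 0 = +oo%E;
  rep_val : forall g c t, gaussv d (shift x (mp g)) c t -> w g = (E%:R * c)%:E;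
  rep_int : forall g c t, gaussv d (shift x (mp g)) c t ->
    exists z : int, E%:R * c = z%:~R;
  rep_group : value_group v (adjoin iota x) E%:R^-1
}.

Lemma gaussv_mp_neq0 d x g c t : gaussv d (shift x (mp g)) c t -> g != 0.
Proof.
by move/(gaussv_neq0 vV); apply: contra_neq => ->; rewrite /shift rmorph0 comp_poly0.
Qed.

Lemma represents_gauss x : (0 <= v x)%E ->
  represents x (gauss_valuation iota v) 1 0.
Proof.
move=> x0.
have sh0 g c t : gaussv 0 (shift x (mp g)) c t -> gaussv 0 (mp g) c t.
  move=> /(gaussv_center vV (e' := 0)); rewrite subr0 => /(_ x0).
  by rewrite /shift addr0 comp_polyXr.
split=> //.
- by rewrite /gauss_valuation size_poly0 big_ord0.
- move=> g c t /sh0 [h1 h2 _]; rewrite mul1r.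
  apply: bigmin_eq => [i|].
    by have := h1 i; rewrite mulr0 subr0 coef_map.
  have tg : (t < size g)%N.
    rewrite ltnNge; apply/negP => gt; move: h2.
    by rewrite nth_default ?size_map_poly // (v0 vV).
  by exists (Ordinal tg) => /=; move: h2; rewrite mulr0 subr0 coef_map.
- move=> g c t /sh0 [_ + _]; rewrite mulr0 subr0 coef_map mul1r.
  exact: base_value.
- by rewrite invr1; exact: value_group1.
Qed.

Lemma represents_step G rs x w (E : nat) d d' phi :
  G \is monic -> conjugates iota G rs -> x \in rs ->
  key_poly iota v G d' phi -> near iota v G d (size phi).-1 ->
  represents x w E d -> exists E', represents x (maclane_step G w phi) E' d'.
Proof.
move=> Gm Grs xrs key nr [E0 w0 wv wi wg].
have Gx : root (mp G) x by rewrite (conj_mem Grs).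
have phi0 := monic_neq0 (key_monic key).
have mphi0 : mp phi != 0 by rewrite mp_neq0.
have [D0 [t0 hD0]] := gaussv_exists vV x d mphi0.
set D := rval (ev phi x).
have E0' : 0 < E%:R :> rat by rewrite ltr0n.
(* [D0] and [D] are the Gauss values of [phi] at the radii [d] and [d']. The ordinates count
   [E * D0] for each power of [phi], while the terms of minimal value are those for [E * D]; the
   slope makes up the difference. *)
pose l : rat := E%:R * (D - D0).
have wphi : w phi = (E%:R * D0)%:E := wv _ _ _ hD0.
have wa g s : adic_coef phi g s != 0 ->
    w (adic_coef phi g s) = (E%:R * rval (ev (adic_coef phi g s) x))%:E.
  move=> as0; have [t _ h] := near_gaussv vV nr as0 (adic_size key g s) Gx.
  exact: wv h.
have slope : newton_slope w phi G = l.
  have [a00 [a0E [S0 aS SD big]]] := key_endpoints vV v_complete Grs key xrs Gm.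
  have := gaussv_prodX vV x d' rs; rewrite -(conj_prod Grs) => gG.
  have [lo _] := key_adic vV v_complete Grs key xrs (monic_neq0 Gm) gG.
  apply: (@newton_slope_eq _ _ _ _ _ (E%:R * rootsum x d' rs) _ S0).
  - by rewrite wa // a0E mul0e adde0.
  - rewrite wa aS ?oner_eq0 // peval1 (rval1 vV) wphi mulr0 add0e -SD -EFinM.
    by congr (_%:E); rewrite /l -/D; ring.
  - move=> s y; have [->|as0] := eqVneq (adic_coef phi G s) 0.
      by rewrite w0 wphi -EFinM.
    rewrite wa // wphi -EFinM -EFinD => -[<-]; split.
      by rewrite leqNgt; apply: contraNN as0 => /big ->.
    have := lo _ as0; rewrite -/D -(ler_pM2l E0') /l; lra.
pose e := `|denq l|%N.
have eE : (denq l)%:~R = e%:R :> rat by rewrite -[RHS]/(e%:Z%:~R) absz_denq.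
have e0 : (0 < e)%N by rewrite absz_gt0 denq_neq0.
have le : e%:R * l = (numq l)%:~R.
  by rewrite -eE mulrC numqE.
have [z0 hz0] := wi _ _ _ hD0.
exists (e * E)%N; split.
- by rewrite muln_gt0 e0.
- rewrite /maclane_step size_poly0 big_ord0 slope eE.
  by rewrite mulr_infty gtr0_sg ?ltr0n // mul1e.
- move=> g c t hg; have g0 := gaussv_mp_neq0 hg.
  have [lo [s0 s0g [as0 cE]]] := key_adic vV v_complete Grs key xrs g0 hg.
  rewrite /maclane_step slope eE natrM -mulrA EFinM; congr (_ * _)%E.
  have term s : adic_coef phi g s != 0 ->
      (w (adic_coef phi g s) + s%:R%:E * w phi + (s%:R * l)%:E)%E =
      (E%:R * (rval (ev (adic_coef phi g s) x) + s%:R * D))%:E.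
    move=> as_; rewrite wa // wphi -EFinM -!EFinD /l; congr (_%:E); ring.
  apply: bigmin_eq => [s|]; last by exists (Ordinal s0g); rewrite /= term // cE.
  have [->|as_] := eqVneq (adic_coef phi g s) 0.
    by rewrite w0 wphi -EFinM leey.
  by rewrite term // lee_fin ler_pM2l // lo.
- move=> g c t hg; have g0 := gaussv_mp_neq0 hg.
  have [_ [s _ [as0 ->]]] := key_adic vV v_complete Grs key xrs g0 hg.
  have [t' _ h] := near_gaussv vV nr as0 (adic_size key g s) Gx.
  have [z hz] := wi _ _ _ h.
  exists (e%:Z * z + s%:Z * (numq l + e%:Z * z0)).
  rewrite natrM !rmorphD !rmorphM /= rmorphD rmorphM /= -hz -hz0 -le -!pmulrn /l -/D.
  by ring.
(* With [u h + u' e = 1] and [E * D = l + z0], the combination [u * D + (u' - u * z0) / E] is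
   [(u * l + u') / E], that is, [1 / (e * E)]. *)
- have [u [u' uu]] := Bezoutz (numq l) (denq l).
  have g1 : gcdz (numq l) (denq l) = 1.
    by rewrite /gcdz; have := coprime_num_den l; rewrite /coprime => /eqP ->.
  rewrite g1 in uu; have {}uu : u%:~R * (numq l)%:~R + u'%:~R * e%:R = 1 :> rat.
    by rewrite -eE -!rmorphM -rmorphD /= uu.
  have n0 := irreducible_eval_neq0 (conj_irr Grs) Gx phi0 (key_size key).
  have -> : (e * E)%:R^-1 = u%:~R * D + (u' - u * z0)%:~R * E%:R^-1 :> rat.
    have en0 : e%:R != 0 :> rat by rewrite pnatr_eq0 -lt0n.
    have En0 := lt0r_neq0 E0'.
    rewrite natrM; apply: (mulfI (mulf_neq0 en0 En0)).
    rewrite divff ?mulf_neq0 // -[LHS]uu -le /l rmorphB rmorphM /= -hz0.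
    by field.
  apply: (value_groupD vV); apply: (value_groupMz vV) => //.
  exact: value_group_peval.
Qed.

Lemma represents_chain G rs x w (E : nat) d s dr :
  G \is monic -> conjugates iota G rs -> x \in rs -> chain G d s dr ->
  represents x w E d ->
  near iota v G dr (size G).-1 /\
  exists E', represents x (foldl (maclane_step G) w s) E' dr.
Proof.
move=> Gm Grs xrs ch; elim: ch w E => {d s dr} [d nr w E h|d d' phi s dr key nr _ IH w E h].
  by split=> //; exists E.
by have [E' h'] := represents_step Gm Grs xrs key nr h; apply: IH h'.
Qed.

Lemma maclane_chain G rs x s dr : G \is monic -> conjugates iota G rs ->
  x \in rs -> (0 <= v x)%E -> chain G 0 s dr ->
  near iota v G dr (size G).-1 /\
  represents x (maclane iota v G s) (ramification_index iota v (adjoin iota x)) dr.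
Proof.
move=> Gm Grs xrs x0 ch.
have [nr [E h]] := represents_chain Gm Grs xrs ch (represents_gauss x0).
split=> //; suff -> : ramification_index iota v (adjoin iota x) = E by [].
have Gx : root (mp G) x by rewrite (conj_mem Grs).
have [E0 _ _ hi hg] := h.
apply: (ramification_indexE v_normal) => // r; split=> [|[z ez]]; last first.
  have -> : r = z%:~R * E%:R^-1.
    by rewrite -ez mulrAC divff ?mul1r // pnatr_eq0 -lt0n.
  exact: value_groupMz.
(* Reduction modulo [G] brings the degree below that of [G], where the value at [x] is a Gauss value
   and [rep_int] applies. *)
have ev_int g : ev g x != 0 -> exists z : int, E%:R * rval (ev g x) = z%:~R.
  rewrite -(peval_mod g Gx) => g0.
  have G0 : G != 0 := monic_neq0 Gm.
  have gG : (size (g %% G)%R <= (size G).-1)%N.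
    by rewrite -ltnS prednK ?size_poly_gt0 // ltn_modp.
  have gn0 : g %% G != 0 by apply: contraNneq g0 => ->; rewrite peval0.
  have [t _ /hi //] := near_gaussv vV nr gn0 gG Gx.
move=> [_ [g [g' [g'0 ->]]] vr].
have := v_fin_neq0 vV vr; rewrite mulf_eq0 negb_or => /andP[g0 _].
have [z ez] := ev_int _ g0; have [z' ez'] := ev_int _ g'0.
exists (z - z'); rewrite rmorphB /= -ez -ez' -mulrBr; congr (_ * _).
by rewrite -(rvalE vr) (rvalM vV) ?invr_eq0 // (rvalV vV).
Qed.

End MacLane.

(** * Okutsu frames *)

Section Integrality.
Variables (k : fieldType) (K : closedFieldType) (iota : {rmorphism k -> K}).
Variables (v : K -> \bar rat).
Hypothesis vV : valuation v.
Hypothesis v_complete : complete (v \o iota).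
Implicit Types (g p : {poly k}) (b : K).

Local Notation ev := (peval iota).
Local Notation mp := (map_poly iota).
Local Notation integral := (integral_coefs iota v).

Lemma gaussv0_prodX (bs : seq K) : gaussv v 0 (prodX bs) (rootsum v 0 0 bs)
   (count (fun b => 0%:E <= v (0 - b)%R)%E bs).
Proof.
have := gaussv_prodX vV 0 0 bs.
by rewrite {1}/shift addr0 comp_polyXr.
Qed.

(** At radius 0 the Gauss value of [p] is the sum of the [min (v b) 0], and integrality of the
    coefficients makes it nonnegative; both sides thus say that every summand is 0. *)
Lemma integral_coefsP p : p \is monic ->
  (forall b, root (mp p) b -> (0 <= v b)%E) <-> integral p.
Proof.
move=> pm; have [|bs pbs _] := @monic_prodX K (mp p); first by rewrite map_monic.
have := gaussv0_prodX bs; rewrite -pbs => -[h1 h2 _].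
split=> [h i|int b].
  suff -> : 0%E = (rootsum v 0 0 bs - i%:R * 0)%:E :> \bar rat.
    by rewrite -coef_map.
  rewrite mulr0 subr0 /rootsum big_seq big1 // => b.
  rewrite -root_prodX -pbs => /h b0.
  by rewrite /minv sub0r (vN vV) b0.
rewrite pbs root_prodX => br.
have c0 : rootsum v 0 0 bs = 0.
  apply: le_anti; apply/andP; split.
    have lc : (mp p)`_(size p).-1 = 1.
      by have := map_monic iota p; rewrite pm monicE lead_coefE size_map_poly => /eqP.
    by have := h1 (size p).-1; rewrite mulr0 subr0 lc (v1 vV) lee_fin.
  have := int (count (fun b => 0%:E <= v (0 - b)%R)%E bs).
  by rewrite -coef_map h2 mulr0 subr0 lee_fin.
move: c0; rewrite /rootsum (big_rem b br) /= => c0.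
have : \sum_(y <- rem b bs) minv v 0 (0 - y) <= 0.
  by apply: sumr_le0 => y _; exact: minv_le.
have := minv_le_v vV 0 (0 - b); rewrite sub0r (vN vV) => h h'.
apply: le_trans h; rewrite lee_fin; move: c0; rewrite sub0r; lra.
Qed.

Lemma integral_factor p g : p \is monic -> g \is monic -> p %| g ->
  integral g -> integral p.
Proof.
move=> pm gm pg /(integral_coefsP gm) h; apply/(integral_coefsP pm) => b pb.
by apply: h; move: pg; rewrite -(dvdp_map iota) => /dvdpP[q ->]; rewrite rootM pb orbT.
Qed.

Lemma integral_irreducible p b : p \is monic -> irreducible_poly p ->
  root (mp p) b -> (0 <= v b)%E -> integral p.
Proof.
move=> pm pirr pb b0; apply/(integral_coefsP pm) => b' pb'.
have := conjugate_v vV v_complete pirr pb' pb 'X^1.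
by rewrite !peval_polyXn !expr1 => ->.
Qed.

End Integrality.

Section Frame.
Variables (k : fieldType) (K : closedFieldType) (iota : {rmorphism k -> K}).
Variables (v : K -> \bar rat).
Hypothesis vV : valuation v.
Hypothesis v_complete : complete (v \o iota).

Local Notation ev := (peval iota).
Local Notation mp := (map_poly iota).
Local Notation integral := (integral_coefs iota v).
Local Notation rval := (rval v).
Local Notation rootsum := (rootsum v).

Variables (F : {poly k}) (theta : K) (rs : seq K).
Hypothesis F_integral : integral F.
Hypothesis F_monic : F \is monic.
Hypothesis Frs : conjugates iota F rs.
Hypothesis theta_rs : theta \in rs.
Variables (s : seq {poly k}) (phi : {poly k}).
Hypothesis s_frame : okutsu_frame iota v F theta s.
Hypothesis phi_approx : okutsu_approximation iota v F theta s phi.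

Implicit Types (g p : {poly k}) (b : K) (i : nat).

Local Notation m := (frame_deg s phi).
Local Notation fp := (frame_poly s phi).
Local Notation fv := (frame_val iota v theta s phi).
Local Notation sl g := (v (ev g theta) * ((deg g)%:R^-1)%:E)%E.
Local Notation n := (size rs).

Let F_theta : root (mp F) theta. Proof. by rewrite (conj_mem Frs). Qed.

Lemma degF : deg F = n. Proof. by rewrite /deg (conj_size Frs). Qed.

Lemma conj_integral x : root (mp F) x -> (0 <= v x)%E.
Proof. exact: ((integral_coefsP iota vV F_monic).2 F_integral x). Qed.

Lemma frame_degE i : m i = nth 1%N (1%N :: rcons (map (@deg k) s) (deg F)) i.
Proof.
by rewrite /frame_deg map_rcons; case: phi_approx => _ _ _ -> _.
Qed.

Lemma frame_deg_last : m (size s).+1 = deg F.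
Proof. by rewrite frame_degE /= nth_rcons size_map ltnn eqxx. Qed.

(** Index 0 is excluded because [m 0 = 1] may equal [m 1]. *)
Lemma frame_deg_lt i : (0 < i <= size s)%N -> (m i < m i.+1)%N.
Proof.
case: s_frame => _ /(pathP 1%N) h _ /andP[i0 is_]; rewrite !frame_degE /=.
have := h i; rewrite size_rcons size_map ltnS is_ => /(_ isT).
by case: i i0 is_.
Qed.

Lemma frame_deg_gt0 i : (i <= size s)%N -> (0 < m i.+1)%N.
Proof.
case: s_frame => _ /(pathP 1%N) h _ is_; rewrite frame_degE /=.
have := h i; rewrite size_rcons size_map ltnS is_ => /(_ isT).
exact: leq_trans.
Qed.

Lemma frame_deg_le i : (i <= (size s).+1)%N -> (m i <= deg F)%N.
Proof.
case: i => [_|i]; first by rewrite degF (conj_gt0 Frs).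
rewrite ltnS => is_; rewrite -frame_deg_last.
suff H j : (i <= j)%N -> (j <= size s)%N -> (m i.+1 <= m j.+1)%N by exact: H.
elim: j => [|j IH] ij js; first by move: ij; rewrite leqn0 => /eqP ->.
move: ij; rewrite leq_eqVlt => /orP[/eqP -> //|ij].
by apply: leq_trans (IH ij (ltnW js)) _; apply/ltnW/frame_deg_lt.
Qed.

Lemma frame_polyP i : (0 < i <= size s)%N ->
  [/\ integral (fp i), fp i \is monic, deg (fp i) = m i & fp i = nth 1 s i.-1].
Proof.
case: i => //= i is_; rewrite /frame_poly /= nth_rcons is_.
have [/(_ _ (mem_nth 1 is_)) [a1 a2 a3] _ _] := s_frame.
split=> //; rewrite frame_degE /= nth_rcons size_map is_.
by rewrite (nth_map 1).
Qed.

Lemma frame_ineq i g : (i <= size s)%N -> integral g -> g \is monic ->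
  (m i <= deg g < m i.+1)%N -> (sl g <= fv i)%E /\ (fv i < fv i.+1)%E.
Proof.
by move=> is_ gi gm gd; case: s_frame => _ _ /(_ phi phi_approx g gi gm i is_ gd).
Qed.

Lemma frame_valE i : (0 < i <= size s)%N -> fv i = sl (fp i).
Proof. by move=> h; have [_ _ e _] := frame_polyP h; rewrite /frame_val -e. Qed.

Lemma frame_val_lt i : (0 < i <= size s)%N -> (fv i < fv i.+1)%E.
Proof.
move=> h; have [a1 a2 a3 _] := frame_polyP h; have /andP[_ is_] := h.
by have [] := frame_ineq is_ a1 a2 (i := i); rewrite ?a3 ?leqnn ?frame_deg_lt.
Qed.

(** The frame condition compares [g] only with the frame polynomial of its own degree range; the
    strict growth of [fv] carries the comparison to higher indices. *)
Lemma frame_slope_lt i g : (0 < i <= (size s).+1)%N -> integral g ->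
  g \is monic -> (0 < deg g < m i)%N -> (sl g < fv i)%E.
Proof.
move=> + gi gm; elim: i => // i IH /andP[_ is_] /andP[g0 gd].
case: (leqP (m i) (deg g)) => gi'.
  have [h1 h2] : (sl g <= fv i)%E /\ (fv i < fv i.+1)%E.
    by apply: frame_ineq => //; rewrite gi' gd.
  exact: le_lt_trans h1 h2.
case: (posnP i) gi' => [->|i0 gi']; first by rewrite /frame_deg /= ltnNge g0.
apply: (@lt_trans _ _ (fv i)).
  by apply: IH; rewrite ?i0 ?g0 // ltnW.
by apply: frame_val_lt; rewrite i0.
Qed.

Lemma frame_slope_le i g : (0 < i <= size s)%N -> integral g ->
  g \is monic -> (0 < deg g < m i.+1)%N -> (sl g <= fv i)%E.
Proof.
move=> /andP[i0 is_] gi gm /andP[g0 gd].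
case: (leqP (m i) (deg g)) => gi'.
  by have [] := @frame_ineq i g is_ gi gm; rewrite ?gi' ?gd.
by apply/ltW/frame_slope_lt; rewrite ?i0 ?g0 // ltnW.
Qed.

Lemma slE g : ev g theta != 0 -> sl g = (rval (ev g theta) / (deg g)%:R)%:E.
Proof. by move=> g0; rewrite (vE vV g0). Qed.

Lemma eval_neq0 g : g != 0 -> (deg g < n)%N -> ev g theta != 0.
Proof.
move=> g0 gn; apply: (irreducible_eval_neq0 (conj_irr Frs) F_theta g0).
by rewrite (conj_size Frs) ltnS -(prednK (n := size g)) // size_poly_gt0.
Qed.

Lemma frame_poly_lt i : (0 < i <= size s)%N -> (deg (fp i) < n)%N.
Proof.
move=> h; have [_ _ -> _] := frame_polyP h; rewrite -degF.
apply: leq_trans (frame_deg_lt h) _; apply: frame_deg_le.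
by case/andP: h.
Qed.

(** The slope of a product is a weighted mean of the slopes of its factors, whereas a proper monic
    factor is integral of smaller degree and has strictly smaller slope. *)
Lemma frame_poly_irr i : (0 < i <= size s)%N -> irreducible_poly (fp i).
Proof.
move=> h; have [fi fm fd _] := frame_polyP h.
have f0 := monic_neq0 fm.
have i1 : (i.-1 <= size s)%N by case/andP: h => i0 is_; apply: leq_trans (leq_pred _) is_.
have d0 : (0 < deg (fp i))%N.
  by rewrite fd; have := frame_deg_gt0 i1; rewrite prednK //; case/andP: h.
split; first by move: d0; rewrite /deg -subn1 subn_gt0.
move=> q q1 qf; have q0 : q != 0 by apply: contraTneq qf => ->; rewrite dvd0p.
apply/negPn/negP => nq.
pose p := (lead_coef q)^-1 *: q; pose r := fp i %/ p.
have lq : (lead_coef q)^-1 != 0 by rewrite invr_eq0 lead_coef_eq0.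
have pm : p \is monic by rewrite monicE lead_coefZ mulVf // lead_coef_eq0.
have pf : p %| fp i by rewrite dvdpZl.
have fE : fp i = r * p by rewrite divpK.
have rm : r \is monic by rewrite -(monicMr _ pm) -fE.
have rf : r %| fp i by rewrite fE dvdp_mulr.
have sz : size (fp i) = (size r + size p).-1 by rewrite fE size_Mmonic // monic_neq0.
have sp : size p = size q by rewrite size_scale.
have p1 : (1 < size p)%N.
  have := size_poly_gt0 q; rewrite sp q0; move: q1.
  by case: (size q) => [|[|]].
have r1 : (1 < size r)%N.
  rewrite ltnNge; apply/negP => r1; case/negP: nq.
  rewrite -dvdp_size_eqp // sz -sp.
  have -> : size r = 1%N by apply/eqP; rewrite eqn_leq r1 size_poly_gt0 monic_neq0.
  by rewrite add1n.
have dE : deg (fp i) = (deg r + deg p)%N.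
  rewrite /deg sz; move: r1 p1; case: (size r) => [|a] //; case: (size p) => [|b] //=.
  by rewrite addnS.
have dp : (0 < deg p < m i)%N.
  rewrite -fd dE /deg -!subn1 subn_gt0 p1 /= -{1}[(size p - 1)%N]add0n ltn_add2r.
  by rewrite subn_gt0.
have dr : (0 < deg r < m i)%N.
  rewrite -fd dE /deg -!subn1 subn_gt0 r1 /= -{1}[(size r - 1)%N]addn0 ltn_add2l.
  by rewrite subn_gt0.
have h' : (0 < i <= (size s).+1)%N by case/andP: h => -> /= /leqW.
have lp := frame_slope_lt h' (integral_factor vV pm fm pf fi) pm dp.
have lr := frame_slope_lt h' (integral_factor vV rm fm rf fi) rm dr.
have fe0 := eval_neq0 f0 (frame_poly_lt h).
move: (fe0); rewrite {1}fE pevalM mulf_eq0 negb_or => /andP[re0 pe0].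
move: lp lr; rewrite frame_valE // !slE // !lte_fin.
have d0' : 0 < (deg (fp i))%:R :> rat by rewrite ltr0n.
have dp0 : 0 < (deg p)%:R :> rat by rewrite ltr0n; case/andP: dp.
have dr0 : 0 < (deg r)%:R :> rat by rewrite ltr0n; case/andP: dr.
rewrite !ltr_pdivrMr //; set f := _ / _ => lp lr.
have : rval (ev (fp i) theta) = f * (deg (fp i))%:R by rewrite divfK // gt_eqF.
rewrite {1}fE pevalM (rvalM vV) // dE natrD; lra.
Qed.

(* For an irreducible g the slope of g is an increasing function of the largest
   distance between a root of g and a root of F. *)
Lemma slope_rootsum p b : p \is monic -> irreducible_poly p -> (deg p < n)%N ->
  root (mp p) b ->
  exists d, [/\ sl p = (rootsum theta d rs / n%:R)%:E,
                exists2 x, root (mp F) x & v (x - b) = d%:E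
              & forall y, root (mp F) y -> (v (y - b)%R <= d%:E)%E].
Proof.
move=> pm pirr pn pb; have p0 := monic_neq0 pm.
have pF : (size p < size F)%N.
  by rewrite (conj_size Frs) ltnS -(prednK (n := size p)) // size_poly_gt0.
have [d [h1 [x xr xb] h2]] := closest_conj_eval vV v_complete Frs (conj_eval_neq0 Frs p0 pF pb).
exists d; split; last 2 first.
- by exists x; rewrite // (conj_mem Frs).
- by move=> y; rewrite (conj_mem Frs); exact: h2.
rewrite slE ?eval_neq0 //; congr (_%:E).
have := v_resultant_irr vV v_complete Frs theta_rs pm pirr pF pb.
rewrite (h1 _ theta_rs) => e.
have n0 : n%:R != 0 :> rat by rewrite pnatr_eq0 -lt0n (conj_gt0 Frs).
have d0 : (deg p)%:R != 0 :> rat.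
  by rewrite pnatr_eq0 -lt0n /deg -subn1 subn_gt0 pirr.1.
apply: (mulIf d0); rewrite divfK //; apply: (mulfI n0).
by rewrite e /deg; field.
Qed.

(** The frame condition speaks of integral polynomials, [near] and [far] of all: roots of negative
    value are harmless because they stay far from the roots of [F]. *)
Lemma nonintegral_near x b : root (mp F) x -> (v b < 0)%E -> v (x - b) = v b.
Proof.
move=> /conj_integral x0 b0; rewrite (v_subC vV) (v_add_lt vV) // (vN vV).
exact: lt_le_trans b0 x0.
Qed.

Lemma integral_diff x b : root (mp F) x -> (0 <= v b)%E -> (0 <= v (x - b)%R)%E.
Proof. by move=> /conj_integral x0 b0; apply: (vge_sub vV). Qed.

Lemma frame_near0 : near iota v F 0 (m 1).
Proof.
move=> p b x p0 pm1 pb Fx.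
have [q [qm qirr qb qp]] := irreducible_factor p0 pb.
case: (ltP (v b) 0%E) => b0; first by rewrite nonintegral_near // ltW.
have qi := integral_irreducible vV v_complete qm qirr qb b0.
have dq : (0 < deg q < m 1)%N.
  rewrite /deg -subn1 subn_gt0 qirr.1 /= subn1 prednK ?size_poly_gt0 ?monic_neq0 //.
  exact: leq_trans (dvdp_leq p0 qp) pm1.
have [+ _] := @frame_ineq 0 q (leq0n _) qi qm dq.
have q0 : ev q theta != 0.
  apply: eval_neq0; first exact: monic_neq0.
  by rewrite -degF; case/andP: dq => _ /leq_trans; apply; exact: frame_deg_le.
have -> : fv 0 = 0%E by rewrite /frame_val /= peval1 (v1 vV) mul0e.
have dq0 : 0 < (deg q)%:R :> rat by rewrite ltr0n; case/andP: dq.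
rewrite slE // lee_fin ler_pdivrMr // mul0r => vq.
(* A root of [q] closer than 0 to [x] would put the value of [q] at [x] above the Gauss value at
   radius 0, which is 0 as all roots involved are integral. *)
rewrite leNgt; apply/negP => lt.
have [bs qbs] := conjugatesP iota qm qirr.
have bbs : b \in bs by rewrite -(conj_mem qbs).
have := v_prodX_gt vV bbs lt; rewrite -(conj_horner _ qbs).
rewrite (conjugate_v vV v_complete (conj_irr Frs) Fx F_theta) (vE vV q0) lte_fin.
suff -> : rootsum x 0 bs = 0 by rewrite ltNge vq.
rewrite /rootsum big_seq big1 // => b'; rewrite -(conj_mem qbs) => qb'.
rewrite /minv integral_diff //.
exact: ((integral_coefsP iota vV qm).2 qi _ qb').
Qed.

(** The slope of an irreducible polynomial grows strictly with its distance to the roots of [F], so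
    the weak frame inequality becomes [near] and the strict one becomes [far]. Arbitrary polynomials
    are reduced to the irreducible factor that has the given root. *)
Lemma frame_key i : (0 < i <= size s)%N ->
  exists d, [/\ key_poly iota v F d (fp i), near iota v F d (m i.+1)
              & fv i = (rootsum theta d rs / n%:R)%:E].
Proof.
move=> h; have [fi fm fd _] := frame_polyP h; have firr := frame_poly_irr h.
have [as_ fas] := conjugatesP iota fm firr.
have [a ra] : exists a, root (mp (fp i)) a.
  have := conj_gt0 fas; case: (as_) fas => // a l fas _.
  by exists a; rewrite (conj_mem fas) mem_head.
have fn := frame_poly_lt h; have f0 := monic_neq0 fm.
have [d [fE [x Fx xa] dmax]] := slope_rootsum fm firr fn ra.
have n0 : 0 < n%:R :> rat by rewrite ltr0n (conj_gt0 Frs).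
have d0 : (0%:E <= d%:E :> \bar rat)%E.
  rewrite -xa; apply: integral_diff => //.
  exact: ((integral_coefsP iota vV fm).2 fi _ ra).
have F0 := monic_neq0 F_monic.
have reduce p b y j : p != 0 -> (size p <= m j)%N -> (j <= (size s).+1)%N ->
    root (mp p) b -> root (mp F) y ->
    (v (y - b)%R < 0)%E \/ exists q d', [/\ integral q, q \is monic,
      (0 < deg q < m j)%N, sl q = (rootsum theta d' rs / n%:R)%:E
      & (v (y - b)%R <= d'%:E)%E].
  move=> p0 pj js pb Fy.
  case: (ltP (v b) 0%E) => b0; first by left; rewrite nonintegral_near.
  right; have [q [qm qirr qb qp]] := irreducible_factor p0 pb.
  have dq : (0 < deg q < m j)%N.
    rewrite /deg -subn1 subn_gt0 qirr.1 /= subn1 prednK ?size_poly_gt0 ?monic_neq0 //.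
    exact: leq_trans (dvdp_leq p0 qp) pj.
  have qn : (deg q < n)%N.
    by rewrite -degF; case/andP: dq => _ /leq_trans; apply; exact: frame_deg_le.
  have [d' [e1 _ e2]] := slope_rootsum qm qirr qn qb.
  exists q, d'; split=> //; last exact: e2.
  exact: (integral_irreducible vV v_complete qm qirr qb b0).
have /andP[i0 is_] := h.
have nr : near iota v F d (m i.+1).
  move=> p b y p0 pm pb Fy.
  have [lt|[q [d' [qi qm dq qE le]]]] := reduce p b y i.+1 p0 pm is_ pb Fy.
    exact: le_trans (ltW lt) d0.
  apply: le_trans le _; rewrite lee_fin leNgt; apply/negP => /(rootsum_lt vV theta_rs).
  have := frame_slope_le h qi qm dq; rewrite frame_valE // fE qE lee_fin.
  by rewrite ler_pM2r ?invr_gt0 // leNgt => /negP.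
have sf : size (fp i) = (m i).+1 by rewrite -fd /deg prednK // size_poly_gt0.
exists d; split=> //; last by rewrite frame_valE.
split=> //.
- by rewrite (conj_size Frs) sf ltnS -fd.
- rewrite sf /= => p b y p0 pm pb Fy.
  have [lt|[q [d' [qi qm dq qE le]]]] := reduce p b y i p0 pm (leqW is_) pb Fy.
    exact: lt_le_trans lt d0.
  apply: le_lt_trans le _; rewrite lte_fin ltNge; apply/negP => /(rootsum_mono vV theta rs).
  have h' : (0 < i <= (size s).+1)%N by rewrite i0 leqW.
  have := frame_slope_lt h' qi qm dq; rewrite frame_valE // fE qE lte_fin.
  by rewrite ltr_pM2r ?invr_gt0 // ltNge => /negP.
- move=> p b y p0 pm; apply: nr => //; apply: leq_trans pm _.
  by rewrite sf frame_deg_lt.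
- by exists a, x.
Qed.

Lemma chain_drop i d : (i <= size s)%N -> near iota v F d (m i.+1) ->
  fv i = (rootsum theta d rs / n%:R)%:E ->
  exists dr, chain iota v F d (drop i s) dr /\
    ((rootsum theta dr rs)%:E < v (ev phi theta))%E.
Proof.
have [j] := ubnP (size s - i)%N; elim: j i d => // j IH i d ij is_ nr fvE.
have n0 : 0 < n%:R :> rat by rewrite ltr0n (conj_gt0 Frs).
move: is_; rewrite leq_eqVlt => /orP[/eqP iE|is_].
  exists d; split.
    rewrite iE drop_size; apply: ChainNil.
    by rewrite -[(size F).-1]/(deg F) -frame_deg_last -iE.
  case: phi_approx => _ _ _ dphi; rewrite -iE fvE /frame_val iE frame_deg_last degF.
  rewrite /frame_poly /= nth_rcons ltnn eqxx.
  have [->|e0] := eqVneq (ev phi theta) 0; first by rewrite (v0 vV) ltry.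
  by rewrite (vE vV e0) !lte_fin ltr_pM2r // invr_gt0.
have h : (0 < i.+1 <= size s)%N by [].
have [d' [key nr' fvE']] := frame_key h.
have [_ _ fd fE] := frame_polyP h.
have [||||dr [ch lt]] := IH i.+1 d' => //.
  by move: ij; rewrite ltnS; apply: leq_trans; rewrite ltn_sub2l.
exists dr; split=> //.
rewrite (drop_nth 1) // -[nth 1 s i]fE; apply: ChainCons key _ ch.
by rewrite -[(size _).-1]/(deg (fp i.+1)) fd.
Qed.

Lemma frame_chain : exists dr, chain iota v F 0 s dr /\
  ((rootsum theta dr rs)%:E < v (ev phi theta))%E.
Proof.
rewrite -[s]drop0; apply: chain_drop frame_near0 _ => //.
(* The chain starts at distance 0: the conjugates are integral, so the Gauss value of [F] at radius
   0 is 0, as is the slope of the polynomial 1 at index 0. *)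
rewrite /frame_val /= peval1 (v1 vV) mul0e /rootsum big_seq big1 ?mul0r // => b.
rewrite -(conj_mem Frs) => /conj_integral b0.
by rewrite /minv integral_diff.
Qed.

End Frame.

(** * Okutsu approximations *)

Section Lagrange.
Variables (K : fieldType) (n : nat) (x : 'I_n -> K).
Hypothesis x_inj : injective x.

Let basis i := \prod_(j < n | j != i) ('X - (x j)%:P).

Lemma lagrange_basis i : basis i \is monic /\ size (basis i) = n.
Proof.
have sz : size (\prod_(j < n) ('X - (x j)%:P)) = n.+1.
  by rewrite size_prod_XsubC /index_enum -enumT size_enum_ord.
have bm : basis i \is monic by apply: monic_prod_XsubC.
split=> //; move: sz; rewrite (bigD1 i) //= size_Mmonic ?polyXsubC_eq0 //.
by rewrite size_XsubC add2n => -[].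
Qed.

Lemma lagrange_diff_neq0 i : \prod_(j < n | j != i) (x i - x j) != 0.
Proof.
apply/prodf_neq0 => j ji; rewrite subr_eq0; apply: contra ji => /eqP e.
by rewrite (x_inj e).
Qed.

(** The top coefficient of the interpolation formula. It serves twice: at perturbed conjugates for
    the bound on [mu], at the conjugates for Euler's formula. *)
Lemma lagrange_lead (p : {poly K}) : (size p <= n)%N ->
  p`_n.-1 = \sum_(i < n) p.[x i] / \prod_(j < n | j != i) (x i - x j).
Proof.
move=> pn; pose c i := p.[x i] / \prod_(j < n | j != i) (x i - x j).
pose q := \sum_(i < n) c i *: basis i.
have hb i l : (basis i).[x l] = \prod_(j < n | j != i) (x l - x j).
  by rewrite horner_prod; apply: eq_bigr => j _; rewrite hornerXsubC.
have qx l : q.[x l] = p.[x l].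
  rewrite horner_sum (bigD1 l) //= hornerZ hb divfK ?lagrange_diff_neq0 //.
  rewrite big1 ?addr0 // => i il; rewrite hornerZ hb (bigD1 l) 1?eq_sym //=.
  by rewrite subrr mul0r mulr0.
have qn : (size q <= n)%N.
  apply: (leq_trans (size_sum _ _ _)); apply/bigmax_leqP => i _.
  by rewrite (leq_trans (size_scale_leq _ _)) // (lagrange_basis i).2.
have -> : p = q.
  apply/eqP; rewrite -subr_eq0; apply/negPn/negP => pq.
  have := max_poly_roots pq (rs := codom x).
  rewrite size_codom card_ord => h.
  have : (n < size (p - q)%R)%N.
    apply: h; last by rewrite /codom map_inj_uniq ?enum_uniq.
    by apply/allP => _ /codomP[i ->]; rewrite rootE hornerD hornerN qx subrr.
  rewrite ltnNge => /negP; apply; apply: leq_trans (size_polyD _ _) _.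
  by rewrite geq_max pn size_polyN.
rewrite coef_sum; apply: eq_bigr => i _; rewrite coefZ -/(c i).
have [/monicP + sz] := lagrange_basis i; rewrite lead_coefE sz => ->.
by rewrite mulr1 /c -qx.
Qed.

End Lagrange.

Section Perturbation.
Variables (K : closedFieldType) (v : K -> \bar rat).
Hypothesis vV : valuation v.

(** At a root [u] of [prodX (0 :: cs) - 1] the integral factors [u - c] have product 1, so each is a
    unit. The extra 0 keeps the polynomial nonconstant when [cs] is empty. *)
Lemma unit_away (cs : seq K) : (forall c, c \in cs -> (0 <= v c)%E) ->
  exists2 u, (0 <= v u)%E & forall c, c \in cs -> (v (u - c)%R <= 0)%E.
Proof.
move=> cs0; pose P := prodX (0 :: cs) - 1.
have [u /rootP] : exists u, root P u.
  apply/closed_rootP; rewrite size_polyDl.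
    by rewrite size_prod_XsubC.
  by rewrite size_prod_XsubC size_polyN size_poly1.
rewrite hornerD hornerN hornerC horner_prodX => /eqP; rewrite subr_eq0 => /eqP u1.
have u0 : (0 <= v u)%E.
  rewrite leNgt; apply/negP => lt.
  suff : (v 1 < 0)%E by rewrite (v1 vV) ltxx.
  rewrite -u1 big_cons subr0 (valuationM vV) -[X in (_ < X)%E]adde0.
  apply: lte_leD => //.
    rewrite (vE vV) //; apply: contra_eq_neq u1 => e.
    by rewrite big_cons e mulr0 eq_sym oner_eq0.
  elim: cs cs0 {P u1} => [|c cs IH] cs0; first by rewrite big_nil (v1 vV).
  rewrite big_cons (valuationM vV) -[X in (_ <= X)%E]adde0; apply: leeD.
    rewrite (v_add_lt vV) ?(vN vV); first exact: ltW.
    by apply: lt_le_trans lt _; apply: cs0; rewrite mem_head.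
  by apply: IH => c' h; apply: cs0; rewrite inE h orbT.
exists u => // c ccs; rewrite leNgt; apply/negP => lt.
suff : (0%:E < v 1)%E by rewrite (v1 vV) ltxx.
rewrite -u1 (big_rem c) /=; last by rewrite inE ccs orbT.
suff h : (0%:E <= v (\prod_(y <- rem c (0 :: cs)) (u - y))%R)%E.
  by have := vgt_ge_mul vV lt h; rewrite addr0.
rewrite big_seq; elim/big_ind: _ => [|y z y0 z0|y /mem_rem]; first by rewrite (v1 vV).
  by have := vge_mul vV y0 z0; rewrite addr0.
rewrite inE => /orP[/eqP->|/cs0 y0]; first by rewrite subr0.
exact: (vge_sub vV).
Qed.

Lemma perturb (d : rat) (w : K) (rs : seq K) : v w = d%:E ->
  exists xs, [/\ size xs = size rs,
    forall i, (i < size rs)%N -> (d%:E <= v (nth 0 rs i - nth 0 xs i)%R)%E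
    & forall i j, (i < j)%N -> (j < size rs)%N ->
        (v (nth 0 xs i - nth 0 xs j)%R <= d%:E)%E].
Proof.
move=> wd; have w0 := v_fin_neq0 vV wd.
elim: rs => [|e rs [xs [sz near_ far_]]]; first by exists [::].
(* The points already chosen in the ball around [e], rescaled by [w] to integral elements;
   [e + w * u] then avoids them, and points outside the ball are at distance below [d] anyway. *)
pose cs := [seq (y - e) / w | y <- xs & (d%:E <= v (y - e)%R)%E].
have [c|u u0 hu] := @unit_away cs.
  move=> /mapP[y]; rewrite mem_filter => /andP[dy _] ->.
  have w1 : ((- d)%:E <= v w^-1)%E.
    by rewrite (vE vV) ?invr_eq0 // (rvalV vV) // (rvalE wd).
  by have := vge_mul vV dy w1; rewrite subrr.
have wu : (d%:E <= v (w * u)%R)%E.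
  have w1 : (d%:E <= v w)%E by rewrite wd.
  by have := vge_mul vV w1 u0; rewrite addr0.
exists ((e + w * u) :: xs); split=> [|[|i] /=|[|i] [|j] //=].
- by rewrite /= sz.
- by move=> _; rewrite opprD addNKr (vN vV).
- exact: near_.
- rewrite !ltnS => _ jrs; set y := nth 0 xs j.
  case: (leP d%:E (v (y - e))) => cmp.
    have yc : (y - e) / w \in cs.
      by apply/mapP; exists y => //; rewrite mem_filter cmp mem_nth ?sz.
    have -> : e + w * u - y = w * (u - (y - e) / w) by field.
    rewrite (valuationM vV) -[X in (_ <= X)%E]adde0; apply: leeD; first by rewrite wd.
    exact: hu.
  have -> : e + w * u - y = - (y - e) + w * u by ring.
  by rewrite (v_add_lt vV) ?(vN vV); [exact: ltW | exact: lt_le_trans cmp wu].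
- by rewrite !ltnS; exact: far_.
Qed.

End Perturbation.

(** * The upper bound for mu *)

Section MuBound.
Variables (k : fieldType) (K : closedFieldType) (iota : {rmorphism k -> K}).
Variables (v : K -> \bar rat).
Hypothesis vV : valuation v.
Hypothesis v_complete : complete (v \o iota).
Implicit Types (F G : {poly k}).

Local Notation ev := (peval iota).
Local Notation mp := (map_poly iota).
Local Notation rval := (rval v).
Local Notation rootsum := (rootsum v).

(* Lagrange interpolation of h at perturbed conjugates, whose mutual distances
   are the distances of the conjugates of x truncated at d. *)
Lemma mu_bound G rs x d w (h : {poly k}) : conjugates iota G rs -> x \in rs ->
  (0 <= v x)%E -> v w = d%:E -> near iota v G d (size G).-1 -> h \is monic ->
  (size h <= size rs)%N -> (v (ev h x) <= (rootsum x d rs - d)%:E)%E.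
Proof.
move=> Grs xrs x0 wd nr hm hs; have n0 := conj_gt0 Grs.
have Gx : root (mp G) x by rewrite (conj_mem Grs).
(* The interpolation formula reads off the coefficient of degree [n - 1], so [h] is raised to that
   degree; the value does not drop since [x] is integral. *)
pose g := h * 'X^(size rs - size h).
have gm : g \is monic by rewrite monicMl // monicXn.
have gs : size g = size rs.
  by rewrite size_Mmonic ?monicXn ?monic_neq0 // size_polyXn addnS /= subnKC.
have g0 := monic_neq0 gm.
apply: (@le_trans _ _ (v (ev g x))).
  rewrite pevalM (valuationM vV) -{1}[v (ev h x)]adde0; apply: leeD => //.
  rewrite peval_polyXn; elim: (_ - _)%N => [|j IH]; first by rewrite (v1 vV).
  by rewrite exprS; have := vge_mul vV x0 IH; rewrite addr0.
have [xs [sz nears fars]] := perturb vV rs wd.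
pose X (i : 'I_(size rs)) := nth 0 xs i.
pose Y (i : 'I_(size rs)) := nth 0 rs i.
have XY i : (d%:E <= v (Y i - X i)%R)%E by apply: nears; exact: ltn_ord.
have XX i j : i != j -> (v (X i - X j)%R <= d%:E)%E.
  move=> ij; case: (ltngtP i j) => [lt|lt|e]; last by rewrite (ord_inj e) eqxx in ij.
    exact: fars.
  by rewrite (v_subC vV); exact: fars.
have Xinj : injective X.
  move=> i j e; apply/eqP/negPn/negP => /XX; rewrite e subrr => /(v_le_fin vV).
  by rewrite eqxx.
have := @lagrange_lead K (size rs) X Xinj (mp g); rewrite size_map_poly gs leqnn.
have -> : (mp g)`_(size rs).-1 = 1.
  have := map_monic iota g; rewrite gm monicE lead_coefE size_map_poly gs.
  by move/eqP.
move=> /(_ isT) e1.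
(* The terms of the interpolation formula add up to 1, so one of them has value at most 0. *)
have [i hi] : exists i, (v (ev g (X i)) <= v (\prod_(j | j != i) (X i - X j))%R)%E.
  apply: contrapT => /forallNP hn.
  suff : (0%:E < v 1)%E by rewrite (v1 vV) ltxx.
  rewrite e1; apply: (vgt_sum vV) => i _.
  have /negP := hn i; rewrite -ltNge; have ne := lagrange_diff_neq0 Xinj i.
  rewrite -[(mp g).[X i]]/(ev g (X i)).
  have [-> _|e0] := eqVneq (ev g (X i)) 0; first by rewrite mul0r (v0 vV) ltry.
  rewrite !(vE vV) ?mulf_neq0 ?invr_eq0 //.
  by rewrite !lte_fin (rvalM vV) ?invr_eq0 // (rvalV vV) //; lra.
have Yrs : Y i \in rs by rewrite mem_nth.
have GY : root (mp G) (Y i) by rewrite (conj_mem Grs).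
rewrite (conjugate_v vV v_complete (conj_irr Grs) Gx GY).
apply: (@le_trans _ _ (v (ev g (X i)))).
  apply: (v_horner_le vV _ (XY i)); first by rewrite mp_neq0.
  by move=> b gb; apply: nr gb GY => //; rewrite (conj_size Grs) gs.
apply: le_trans hi _; rewrite (vE vV) ?lagrange_diff_neq0 // lee_fin.
rewrite (rval_prod vV) => [|j ji]; last first.
  by rewrite subr_eq0; apply: contra ji => /eqP/Xinj ->.
rewrite (rootsum_conj vV v_complete d Grs xrs Yrs) /rootsum (big_nth 0) big_mkord.
(* The product omits index [i], whose term in [rootsum] is [minv] at 0, that is, [d]: this is the
   [- d] of the bound. *)
rewrite [X in _ <= X - _](bigD1 i) //= {1}/Y subrr {1}/minv (v0 vV) leey.
rewrite addrAC subrr add0r.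
apply: ler_sum => j ji; rewrite -lee_fin -(vE vV); last first.
  by rewrite subr_eq0; apply: contra ji => /eqP/Xinj ->.
rewrite (minv_v vV (XX i j _)) 1?eq_sym // lee_fin.
have -> : X i - X j = (Y i - nth 0 rs j) + ((X i - Y i) - (X j - Y j)).
  by rewrite /Y; ring.
rewrite (minv_add vV) //; apply: (vge_sub vV); by rewrite (v_subC vV).
Qed.

End MuBound.

(** * Transfer of the chain to a close polynomial *)

Section Approximation.
Variables (k : fieldType) (K : closedFieldType) (iota : {rmorphism k -> K}).
Variables (v : K -> \bar rat).
Hypothesis vV : valuation v.
Hypothesis v_complete : complete (v \o iota).

Local Notation ev := (peval iota).
Local Notation mp := (map_poly iota).
Local Notation rval := (rval v).
Local Notation rootsum := (rootsum v).

(** Supplies the scaling element [w] for [mu_bound]: [dr] is a difference of roots in value. *)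
Lemma chain_value (F : {poly k}) d s dr : chain iota v F d s dr ->
  (exists w, v w = d%:E) -> exists w, v w = dr%:E.
Proof.
elim=> {d s dr} // d d' f s dr key _ _ IH _; apply: IH.
by have [a [x [_ _ xa]]] := key_root key; exists (x - a).
Qed.

Variables (F : {poly k}) (rs : seq K) (theta : K).
Hypothesis F_monic : F \is monic.
Hypothesis Frs : conjugates iota F rs.
Hypothesis theta_rs : theta \in rs.
Variables (dr : rat) (phi : {poly k}).
Hypothesis F_near : near iota v F dr (size F).-1.
Hypothesis phi_monic : phi \is monic.
Hypothesis phi_size : size phi = size F.
Hypothesis phi_close : ((rootsum theta dr rs)%:E < v (ev phi theta))%E.

Implicit Types (g p : {poly k}) (x y b : K).

Let F_theta : root (mp F) theta. Proof. by rewrite (conj_mem Frs). Qed.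
Let F0 : F != 0. Proof. exact: monic_neq0. Qed.

Lemma approx_diff_size : (size (phi - F)%R <= (size F).-1)%N.
Proof.
apply/leq_sizeP => j; rewrite leq_eqVlt coefB => /orP[/eqP <-|lt].
  rewrite -{1}phi_size -!lead_coefE (monicP phi_monic) (monicP F_monic).
  by rewrite subrr.
have Fj : (size F <= j)%N by rewrite -(prednK (n := size F)) ?size_poly_gt0.
by rewrite !nth_default ?phi_size // subrr.
Qed.

(** [phi - F] has degree below [n], so its Gauss value is its value at [theta], which is that of
    [phi] and exceeds the Gauss value of [F]. *)
Lemma approx_gaussv x : root (mp F) x ->
  exists t, gaussv v dr (shift x (mp phi)) (rootsum theta dr rs) t.
Proof.
move=> Fx; have xrs : x \in rs by rewrite -(conj_mem Frs).
rewrite (rootsum_conj vV v_complete _ Frs theta_rs xrs).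
have := gaussv_prodX vV x dr rs; rewrite -(conj_prod Frs).
set t := count _ _ => gF.
have [/eqP|g0] := eqVneq (phi - F) 0.
  by rewrite subr_eq0 => /eqP ->; exists t.
have [t' ve gg] := near_gaussv vV F_near g0 approx_diff_size Fx.
exists t; have -> : shift x (mp phi) = shift x (mp F) + shift x (mp (phi - F)).
  by rewrite -shiftD -rmorphD addrC subrK.
apply: (gaussvD vV gF gg); left.
rewrite -lte_fin -ve pevalB (_ : ev F x = 0); last exact/eqP.
rewrite subr0 (conjugate_v vV v_complete (conj_irr Frs) Fx F_theta).
by rewrite (rootsum_conj vV v_complete _ Frs xrs theta_rs).
Qed.

(** Without such a root the value of [phi] at [x] would equal its Gauss value, which is that of [F],
    against [phi_close]. *)
Lemma approx_root x : root (mp F) x ->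
  exists2 y, root (mp phi) y & (dr%:E < v (x - y)%R)%E.
Proof.
move=> Fx; have [t gphi] := approx_gaussv Fx.
have [|ps pps _] := @monic_prodX K (mp phi); first by rewrite map_monic.
apply: contrapT => /forall2NP hn.
have : v (ev phi x) = (rootsum x dr ps)%:E.
  rewrite /peval pps; apply: (v_prodX_near vV) => b bps; rewrite leNgt.
  by have [/negP|/negP //] := hn b; rewrite pps root_prodX bps.
have := gaussv_prodX vV x dr ps; rewrite -pps => /(gaussv_uniq gphi) [<- _].
rewrite (conjugate_v vV v_complete (conj_irr Frs) Fx F_theta) => e.
by move: phi_close; rewrite e ltxx.
Qed.

(** A root closer than [dr] to [theta] is not a root of any nonzero polynomial of degree below [n],
    so the irreducible factor through it is all of [phi]. *)
Lemma approx_irr : irreducible_poly phi.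
Proof.
have [y py lt] := approx_root F_theta.
have [q [qm qirr qy qp]] := irreducible_factor (monic_neq0 phi_monic) py.
suff <- : q = phi by [].
apply/eqP; rewrite -eqp_monic // -dvdp_size_eqp // phi_size eqn_leq.
rewrite -{1}phi_size dvdp_leq ?monic_neq0 //= leqNgt; apply/negP => qF.
have := F_near (monic_neq0 qm) _ qy F_theta.
rewrite -ltnS prednK ?size_poly_gt0 // => /(_ qF).
by rewrite leNgt lt.
Qed.

(** One root of [phi] is close to [theta]; the other roots are its conjugates, so [F] has the same
    large value there, and by monotonicity of [rootsum] this value forces a close root of [F]. *)
Lemma approx_root_sym y : root (mp phi) y ->
  exists2 x, root (mp F) x & (dr%:E < v (x - y)%R)%E.
Proof.
move=> py; have [y0 py0 lt0] := approx_root F_theta.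
have [Fy|Fy] := boolP (root (mp F) y); first by exists y; rewrite // subrr (v0 vV) ltry.
have lt : ((rootsum theta dr rs)%:E < v (ev F y))%E.
  rewrite (conjugate_v vV v_complete approx_irr py py0) (conj_horner _ Frs).
  rewrite (rootsum_center vV rs (ltW lt0)); apply: (v_prodX_gt vV theta_rs).
  by rewrite (v_subC vV).
have [d [h1 [x xrs xy] h2]] := closest_conj_eval vV v_complete Frs Fy.
exists x; first by rewrite (conj_mem Frs).
rewrite xy lte_fin ltNge; apply/negP => /(rootsum_mono vV theta rs).
by move: lt; rewrite (vE vV Fy) (h1 _ theta_rs) lte_fin ltNge => /negP.
Qed.

Lemma approx_eval y g : root (mp phi) y -> (size g <= (size F).-1)%N ->
  v (ev g y) = v (ev g theta).
Proof.
move=> py gs; have [->|g0] := eqVneq g 0; first by rewrite !peval0.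
have [x Fx lt] := approx_root_sym py.
rewrite -(conjugate_v vV v_complete (conj_irr Frs) Fx F_theta).
apply: (v_horner_near vV); first by rewrite mp_neq0.
by move=> b gb; apply: le_lt_trans lt; apply: F_near gb Fx.
Qed.

Lemma v_close x y b : (dr%:E < v (x - y)%R)%E -> (v (x - b)%R <= dr%:E)%E ->
  v (y - b) = v (x - b).
Proof.
move=> xy xb; have -> : y - b = (x - b) + (y - x) by ring.
by rewrite (v_add_lt vV) // (v_subC vV y); exact: le_lt_trans xb xy.
Qed.

Lemma near_approx d m : (m <= (size F).-1)%N -> near iota v F d m ->
  near iota v phi d m.
Proof.
move=> mF nr p b y p0 pm pb py; have [x Fx lt] := approx_root_sym py.
rewrite (v_close lt); first exact: nr pb Fx.
exact: F_near p0 (leq_trans pm mF) pb Fx.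
Qed.

Lemma far_approx d m : (m <= (size F).-1)%N -> far iota v F d m ->
  far iota v phi d m.
Proof.
move=> mF nr p b y p0 pm pb py; have [x Fx lt] := approx_root_sym py.
rewrite (v_close lt); first exact: nr pb Fx.
exact: F_near p0 (leq_trans pm mF) pb Fx.
Qed.

Lemma key_approx d f : key_poly iota v F d f -> key_poly iota v phi d f.
Proof.
move=> [fm firr fs ff fn [a [x [fa Fx xa]]]].
have fF : (size f <= (size F).-1)%N by rewrite -ltnS prednK ?size_poly_gt0.
split=> //.
- by rewrite phi_size.
- by apply: far_approx ff; apply: leq_trans (leq_pred _) fF.
- exact: near_approx fn.
have [y py lt] := approx_root Fx; exists a, y; split=> //.
rewrite (v_close lt) //.
exact: F_near (monic_neq0 fm) fF fa Fx.
Qed.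

Lemma chain_approx d s : chain iota v F d s dr -> chain iota v phi d s dr.
Proof.
move=> ch; have : forall d' s' dr', chain iota v F d' s' dr' -> dr' = dr ->
    chain iota v phi d' s' dr'.
  move=> d' s' dr'; elim=> {d' s' dr'} [d' nr _|d' d'' f s' dr' key nr _ IH e].
    by apply: ChainNil; rewrite phi_size; apply: near_approx.
  apply: ChainCons (key_approx key) _ (IH e); apply: near_approx nr.
  apply: leq_trans (leq_pred _) _.
  by rewrite -ltnS prednK ?size_poly_gt0 ?(key_size key).
by move=> h; exact: h ch erefl.
Qed.

End Approximation.

(** * The different *)

Section Trace.
Variables (k K : fieldType) (iota : {rmorphism k -> K}) (L : set K).

Local Notation mx := (map_mx iota).

Definition basis_col n (b : 'I_n -> K) : 'cV[K]_n := \col_i b i.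

Lemma basis_mx_inj m n (b : 'I_n -> K) (A B : 'M[k]_(m, n)) :
  is_basis iota L b -> (forall i, L ((mx A *m basis_col b) i 0)) ->
  mx A *m basis_col b = mx B *m basis_col b -> A = B.
Proof.
move=> [Lb hb] LA e; apply/row_matrixP => i.
have [c [_ uc]] := hb _ (LA i).
have E (C : 'M[k]_(m, n)) :
    (mx C *m basis_col b) i 0 = \sum_(j < n) iota ((row i C) 0 j) * b j.
  by rewrite mxE; apply: eq_bigr => j _; rewrite !mxE.
have <- := uc (row i A) (E A).
by apply: uc; rewrite e; exact: E.
Qed.

Lemma basis_mx_exists m n (b : 'I_n -> K) (y : 'I_m -> K) :
  is_basis iota L b -> (forall i, L (y i)) ->
  exists A : 'M[k]_(m, n), basis_col y = mx A *m basis_col b.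
Proof.
move=> [Lb hb] Ly.
have /choice[f hf] (i : 'I_m) : exists c : 'rV[k]_n,
    y i = \sum_(j < n) iota (c 0 j) * b j.
  by have [c [h _]] := hb _ (Ly i); exists c.
exists (\matrix_i f i); apply/matrixP => i j; rewrite !mxE hf.
by apply: eq_bigr => l _; rewrite !mxE.
Qed.

(** [field_trace] picks a basis by [xget], so the trace must not depend on it. The bases may have
    different lengths a priori; the transition matrices are rectangular and [Q *m P = 1]
    suffices. *)
Lemma field_traceE n (b : 'I_n -> K) (M : 'M[k]_n) y :
  is_basis iota L b -> (forall z, L z -> L (y * z)) ->
  (forall i, y * b i = \sum_(j < n) iota (M i j) * b j) ->
  field_trace iota L y = \tr M.
Proof.
move=> bb Ly hM.
have colE m (c : 'I_m -> K) (A : 'M[k]_m) :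
    (forall i, y * c i = \sum_(j < m) iota (A i j) * c j) ->
    y *: basis_col c = mx A *m basis_col c.
  by move=> h; apply/colP => i; rewrite !mxE h; apply: eq_bigr => j _; rewrite !mxE.
apply: xget_subset1; first by exists n, b, M.
suff H t : (exists m (c : 'I_m -> K) (A : 'M[k]_m), [/\ is_basis iota L c,
    forall i, y * c i = \sum_(j < m) iota (A i j) * c j & t = \tr A]) -> t = \tr M.
  by move=> t t' /H -> /H ->.
move=> [m [c [A [cb hA ->]]]].
have [P hP] := basis_mx_exists bb cb.1.
have [Q hQ] := basis_mx_exists cb bb.1.
have QP : Q *m P = 1%:M.
  apply: (basis_mx_inj bb) => [i|]; rewrite map_mxM -mulmxA -hP -hQ.
    by rewrite mxE; exact: bb.1.
  by rewrite map_mx1 mul1mx.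
have AE : A = P *m M *m Q.
  apply: (basis_mx_inj cb); rewrite -(colE _ _ _ hA).
    by move=> i; rewrite !mxE; apply: Ly; exact: cb.1.
  by rewrite !map_mxM -!mulmxA -hQ -(colE _ _ _ hM) -scalemxAr -hP.
by rewrite AE mxtrace_mulC mulmxA QP mul1mx.
Qed.

End Trace.

Section Different.
Variables (k : fieldType) (K : closedFieldType) (iota : {rmorphism k -> K}).
Variables (v : K -> \bar rat).
Hypothesis vV : valuation v.

Local Notation ev := (peval iota).
Local Notation mp := (map_poly iota).

Section OneGenerator.
Variables (G : {poly k}) (rs : seq K) (x : K).
Hypothesis Grs : conjugates iota G rs.
Hypothesis G_sep : separable_poly G.
Hypothesis xrs : x \in rs.
Implicit Types (g h : {poly k}) (y z : K).

Local Notation n := (size rs).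
Local Notation L := (adjoin iota x).

Let Gx : root (mp G) x. Proof. by rewrite (conj_mem Grs). Qed.
Let Girr := conj_irr Grs.
Let G0 : G != 0. Proof. by rewrite -size_poly_gt0 (conj_size Grs). Qed.

Lemma adjoinP y : L y <-> exists2 g : {poly k}, (size g <= n)%N & y = ev g x.
Proof.
split=> [[g [h [h0 ->]]]|[g _ ->]]; last exact: adjoin_peval.
have co : coprimep h G.
  rewrite coprimep_sym irreducible_poly_coprime //; apply: contra h0 => /divpK <-.
  by rewrite pevalM (_ : ev G x = 0) ?mulr0 //; exact/eqP.
have /Bezout_eq1_coprimepP[[u w] /= e] := co.
have hu : ev u x = (ev h x)^-1.
  apply: (mulIf h0); rewrite mulVf // -pevalM.
  have := congr1 (fun p => ev p x) e; rewrite pevalD (pevalM _ w).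
  by rewrite (_ : ev G x = 0) ?mulr0 ?addr0 ?peval1 //; exact/eqP.
exists ((g * u) %% G); last by rewrite (peval_mod _ Gx) pevalM hu.
by rewrite -ltnS -(conj_size Grs) ltn_modp.
Qed.

Lemma peval_inj g h : (size g <= n)%N -> (size h <= n)%N ->
  ev g x = ev h x -> g = h.
Proof.
move=> gn hn e; apply/eqP; rewrite -subr_eq0; apply/negPn/negP => gh.
have := irreducible_eval_neq0 Girr Gx gh; rewrite pevalB e subrr eqxx.
suff -> : (size (g - h)%R < size G)%N by move=> /(_ isT).
rewrite (conj_size Grs) ltnS; apply: leq_trans (size_polyD _ _) _.
by rewrite geq_max size_polyN gn hn.
Qed.

Lemma power_basis : is_basis iota L (fun i : 'I_n => x ^+ i).
Proof.
split=> [i|y /adjoinP[g gn ->]].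
  by rewrite -(peval_polyXn iota); exact: adjoin_peval.
have E (c : 'rV[k]_n) : \sum_(i < n) iota (c 0 i) * x ^+ i = ev (rVpoly c) x.
  rewrite (peval_coef iota x (size_poly _ _)); apply: eq_bigr => i _.
  by rewrite coef_rVpoly_ord.
exists (poly_rV g); split=> [|c]; rewrite E.
  by rewrite poly_rV_K.
move=> e; have -> : g = rVpoly c by apply: peval_inj e => //; exact: size_poly.
by rewrite rVpolyK.
Qed.

Lemma uniq_conj : uniq rs.
Proof.
rewrite -separable_prod_XsubC -[\prod_(_ <- _) _]/(prodX rs).
by rewrite -(conj_prod Grs) separable_map.
Qed.

Local Notation e_ := (fun i : 'I_n => nth 0 rs i).

Lemma conj_inj : injective e_.
Proof.
by move=> i j /eqP; rewrite nth_uniq ?uniq_conj // => /eqP/ord_inj.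
Qed.

Lemma conj_root i : root (mp G) (e_ i).
Proof. by rewrite (conj_mem Grs) mem_nth. Qed.

Lemma peval_conj g h i : ev g x = ev h x -> ev g (e_ i) = ev h (e_ i).
Proof.
move=> e; have : G %| g - h by apply: (irreducible_dvd Girr Gx); rewrite pevalB e subrr.
move=> /divpK d; apply/eqP; rewrite -subr_eq0 -pevalB -d pevalM.
by rewrite (_ : ev G (e_ i) = 0) ?mulr0 //; apply/eqP; exact: conj_root.
Qed.

(** The Vandermonde matrix of the conjugates diagonalises multiplication by [ev g x] in the power
    basis. *)
Lemma trace_conj g : iota (field_trace iota L (ev g x)) = \sum_(i < n) ev g (e_ i).
Proof.
have Lg z : L z -> L (ev g x * z) by apply: adjoinM; exact: adjoin_peval.
have [M hM] := basis_mx_exists (y := fun i : 'I_n => ev g x * x ^+ i) power_basis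
  (fun i => Lg _ (power_basis.1 i)).
have {}hM (i : 'I_n) : ev g x * x ^+ i = \sum_(j < n) iota (M i j) * x ^+ j.
  have := congr1 (fun A : 'cV[K]_n => A i 0) hM; rewrite !mxE => ->.
  by apply: eq_bigr => j _; rewrite !mxE.
rewrite (field_traceE power_basis Lg hM) -trace_map_mx.
pose a : 'rV[K]_n := \row_i e_ i.
pose V := Vandermonde n a.
have Vu : V \in unitmx.
  rewrite unitmxE det_Vandermonde unitfE; apply/prodf_neq0 => i _.
  apply/prodf_neq0 => j ij; rewrite !mxE subr_eq0.
  by apply/negP => /eqP/conj_inj e; rewrite e ltnn in ij.
have MV : map_mx iota M *m V = V *m diag_mx (\row_i ev g (e_ i)).
  apply/matrixP => i l; rewrite mul_mx_diag !mxE.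
  under eq_bigr do rewrite !mxE.
  have -> : e_ l ^+ i * ev g (e_ l) = ev (g * 'X^i) (e_ l).
    by rewrite pevalM peval_polyXn mulrC.
  rewrite (@peval_conj _ (\sum_(j < n) M i j *: 'X^j)).
    by rewrite peval_sum; apply: eq_bigr => j _; rewrite pevalZ peval_polyXn.
  rewrite pevalM peval_polyXn hM peval_sum.
  by apply: eq_bigr => j _; rewrite pevalZ peval_polyXn.
have -> : map_mx iota M = V *m diag_mx (\row_i ev g (e_ i)) *m invmx V.
  by rewrite -MV mulmxK.
rewrite mxtrace_mulC mulmxA mulVmx // mul1mx mxtrace_diag.
by apply: eq_bigr => i _; rewrite mxE.
Qed.

Lemma deriv_conj i : ev G^`() (e_ i) = \prod_(j < n | j != i) (e_ i - e_ j).
Proof.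
rewrite /peval -deriv_map (conj_prod Grs) /prodX (big_nth 0) big_mkord.
rewrite (bigD1 i) //= derivM derivXsubC mul1r hornerD hornerM hornerXsubC.
rewrite subrr mul0r addr0 horner_prod.
by apply: eq_bigr => j _; rewrite hornerXsubC.
Qed.

Lemma deriv_neq0 : ev G^`() x != 0.
Proof.
have ix : (index x rs < n)%N by rewrite index_mem.
have -> : x = e_ (Ordinal ix) by rewrite /= nth_index.
rewrite deriv_conj; exact: (lagrange_diff_neq0 conj_inj).
Qed.

(** Summed over the conjugates, the quotients by the derivative are the terms of [lagrange_lead]. *)
Lemma trace_euler g : (size g <= n)%N ->
  field_trace iota L (ev g x / ev G^`() x) = g`_n.-1.
Proof.
move=> gn; apply: (fmorph_inj iota).
have [|h _ hE] := (adjoinP (ev g x / ev G^`() x)).1.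
  by apply: adjoinM; [|apply: adjoinV]; exact: adjoin_peval.
rewrite hE trace_conj -coef_map (lagrange_lead conj_inj); last by rewrite size_map_poly.
apply: eq_bigr => i _; rewrite -deriv_conj.
have d0 : ev G^`() (e_ i) != 0.
  by rewrite deriv_conj; exact: (lagrange_diff_neq0 conj_inj).
apply: (mulIf d0); rewrite divfK // -pevalM -[(mp g).[_]]/(ev g (e_ i)).
by apply: peval_conj; rewrite pevalM -hE divfK // deriv_neq0.
Qed.

(** By Euler's formula the coefficient of degree [n - 1] is the trace of [ev h x] divided by the
    derivative at [x]. So this is membership of [g(x) / G'(x)] in the codifferent, stated through
    coefficients and values only. *)
Definition dual_poly g := forall h, (size h <= n)%N ->
  (v (ev g x) <= v (ev h x))%E -> (0 <= v (iota h`_n.-1))%E.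

Lemma codifferentP y : codifferent iota v L y <->
  exists g, [/\ (size g <= n)%N, y = ev g x / ev G^`() x & dual_poly g].
Proof.
have d0 := deriv_neq0.
split=> [[Ly hy]|[g [gn -> dg]]].
  have [|g gn gE] := (adjoinP (y * ev G^`() x)).1.
    by apply: adjoinM => //; exact: adjoin_peval.
  have yE : y = ev g x / ev G^`() x by rewrite -gE mulfK.
  exists g; split=> // h hn le.
  have [g0|g0] := eqVneq (ev g x) 0.
    move: le; rewrite g0 (v0 vV) leye_eq => /eqP/(valuation0P vV) h0.
    have -> : h = 0 by apply: peval_inj; rewrite ?size_poly0 // peval0.
    by rewrite coef0 rmorph0 (v0 vV) leey.
  have := hy (ev h x / ev g x).
  have -> : y * (ev h x / ev g x) = ev h x / ev G^`() x.
    by rewrite yE; field; rewrite g0 d0.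
  rewrite trace_euler //; apply; split.
    by apply: adjoinM; [|apply: adjoinV]; exact: adjoin_peval.
  have [->|h0] := eqVneq (ev h x) 0; first by rewrite mul0r (v0 vV) leey.
  move: le; rewrite !(vE vV) ?mulf_neq0 ?invr_eq0 // !lee_fin.
  by rewrite (rvalM vV) ?invr_eq0 // (rvalV vV) // subr_ge0.
split=> [|z [Lz z0]].
  by apply: adjoinM; [|apply: adjoinV]; exact: adjoin_peval.
have [|h hn hE] := (adjoinP (ev g x * z)).1.
  by apply: adjoinM => //; exact: adjoin_peval.
rewrite mulrAC hE trace_euler //; apply: dg => //.
by rewrite -hE (valuationM vV) -{1}[v (ev g x)]adde0; apply: leeD.
Qed.

Lemma differentP g : (size g <= n)%N -> different iota v L (ev g x) <->
  forall h, (size h <= n)%N -> dual_poly h ->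
    (v (ev G^`() x) <= v (ev h x) + v (ev g x))%E.
Proof.
have d0 := deriv_neq0.
have E h : (0 <= v (ev h x / ev G^`() x * ev g x)%R)%E =
    (v (ev G^`() x) <= v (ev h x) + v (ev g x))%E.
  rewrite -(valuationM vV).
  have [e|ne] := eqVneq (ev h x * ev g x) 0.
    by rewrite mulrAC e mul0r (v0 vV) !leey.
  have ine : (ev G^`() x)^-1 != 0 by rewrite invr_eq0.
  rewrite mulrAC !(vE vV) ?(mulf_neq0 ne ine) // !lee_fin.
  by rewrite (rvalM vV ne ine) (rvalV vV) // subr_ge0.
move=> gn; split=> [[_ hg] h hn dh|hg].
  rewrite -E; apply: (hg _ _).2; apply/codifferentP; by exists h.
split; first exact: adjoin_peval.
move=> _ /codifferentP[h [hn -> dh]]; split; last by rewrite E; exact: hg.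
apply: adjoinM; last exact: adjoin_peval.
by apply: adjoinM; [|apply: adjoinV]; exact: adjoin_peval.
Qed.

End OneGenerator.

Lemma value_group_eq (G H : {poly k}) rs ts (x y : K) :
  conjugates iota G rs -> x \in rs -> conjugates iota H ts -> y \in ts ->
  size rs = size ts ->
  (forall g : {poly k}, (size g <= size rs)%N -> v (ev g x) = v (ev g y)) ->
  value_group v (adjoin iota x) = value_group v (adjoin iota y).
Proof.
move=> Grs xrs Hts yts st e; apply/seteqP; split=> r [z Lz hr].
  have [g gn gE] := (adjoinP Grs xrs z).1 Lz; rewrite gE in hr.
  by exists (ev g y); [exact: adjoin_peval|rewrite -e].
have [g gn gE] := (adjoinP Hts yts z).1 Lz; rewrite gE in hr.
by exists (ev g x); [exact: adjoin_peval|rewrite e // st].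
Qed.

Lemma ramification_index_eq (L M : set K) :
  value_group v L = value_group v M ->
  ramification_index iota v L = ramification_index iota v M.
Proof. by rewrite /ramification_index => ->. Qed.

(** Sending [ev g x] to [ev g y] for reduced [g] need not be multiplicative, but it preserves values
    and coefficients, and [dual_poly] and [differentP] involve nothing else besides the value of the
    derivative. *)
Lemma ideal_valuation_different_eq (G H : {poly k}) rs ts (x y : K) :
  conjugates iota G rs -> separable_poly G -> x \in rs ->
  conjugates iota H ts -> separable_poly H -> y \in ts ->
  size rs = size ts ->
  (forall g : {poly k}, (size g <= size rs)%N -> v (ev g x) = v (ev g y)) ->
  v (ev G^`() x) = v (ev H^`() y) ->
  ideal_valuation iota v (adjoin iota x) (different iota v (adjoin iota x)) =
  ideal_valuation iota v (adjoin iota y) (different iota v (adjoin iota y)).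
Proof.
move=> Grs Gs xrs Hts Hs yts st e de.
have re := ramification_index_eq (value_group_eq Grs xrs Hts yts st e).
have dualE (g : {poly k}) : (size g <= size rs)%N -> dual_poly rs x g <-> dual_poly ts y g.
  rewrite /dual_poly -st => gn.
  by split=> h q qn; have := h q qn; rewrite !e.
have diffE (g : {poly k}) : (size g <= size rs)%N ->
    different iota v (adjoin iota x) (ev g x) <->
    different iota v (adjoin iota y) (ev g y).
  move=> gn; rewrite (differentP Grs Gs xrs gn) (differentP Hts Hs yts); last by rewrite -st.
  rewrite -st de; split=> h q qn dq.
    by rewrite -(e q) // -(e g) //; apply: h => //; apply/dualE.
  by rewrite (e q) // (e g) //; apply: h => //; apply/dualE.
rewrite /ideal_valuation; congr minimum; rewrite /normalized_valuation re.
apply/seteqP; split=> _ [z dz <-].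
  have [g gn gE] := (adjoinP Grs xrs z).1 dz.1.
  exists (ev g y); first by apply/diffE; rewrite // -gE.
  by rewrite gE e.
have [g gn gE] := (adjoinP Hts yts z).1 dz.1.
rewrite -st in gn.
exists (ev g x); first by apply/diffE; rewrite // -gE.
by rewrite gE e.
Qed.

End Different.

(** * Comparison of mu, and the theorem *)

Section Mu.
Variables (k K : fieldType) (iota : {rmorphism k -> K}) (v : K -> \bar rat).

Lemma mu_eq (F G : {poly k}) (x y : K) : deg F = deg G ->
  (forall g, (deg g < deg F)%N -> v (peval iota g x) = v (peval iota g y)) ->
  mu iota v F x = mu iota v G y.
Proof.
move=> d e; rewrite /mu -d; congr maximum; apply/seteqP; split=> r.
  by move=> [g [gi gm gd ->]]; exists g; rewrite e.
by move=> [g [gi gm gd ->]]; exists g; rewrite e.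
Qed.

(* The maximum defining mu defaults to 0 when it does not exist. *)
Lemma mu_cases (F : {poly k}) x : mu iota v F x = 0%E \/
  exists g, [/\ g \is monic, (deg g < deg F)%N & mu iota v F x = v (peval iota g x)].
Proof.
rewrite /mu /maximum; case: xgetP => [_ _ [[g [_ gm gd ->]] _]|_]; last by left.
by right; exists g.
Qed.

End Mu.

Theorem theorem1p11 (k : fieldType) (K : closedFieldType)
    (iota : {rmorphism k -> K}) (v : K -> \bar rat)
    (k_local : local_field iota v)
    (F : {poly k}) (theta : K)
    (F_integral : integral_coefs iota v F) (F_monic : F \is monic)
    (F_irr : irreducible_poly F) (F_sep : separable_poly F)
    (F_theta : root (map_poly iota F) theta)
    (L_wild : wildly_ramified iota v (adjoin iota theta))
    (s : seq {poly k}) (s_frame : okutsu_frame iota v F theta s)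
    (phi : {poly k}) (phi_approx : okutsu_approximation iota v F theta s phi)
    (h_gt : (rho iota v s F theta < hphi iota v s F phi)%E)
    (eta : K) (phi_eta : root (map_poly iota phi) eta) :
  rho iota v s phi eta = rho iota v s F theta /\
  ideal_valuation iota v (adjoin iota theta)
      (different iota v (adjoin iota theta)) =
  ideal_valuation iota v (adjoin iota eta)
      (different iota v (adjoin iota eta)).
Proof.
have [_ vV v_normal v_complete _] := k_local.
have [phi_int phi_monic phi_sep phi_deg _] := phi_approx.
have [rs Frs] := conjugatesP iota F_monic F_irr.
have theta_rs : theta \in rs by rewrite -(conj_mem Frs).
have theta0 := (integral_coefsP iota vV F_monic).2 F_integral _ F_theta.
have eta0 := (integral_coefsP iota vV phi_monic).2 phi_int _ phi_eta.
have [dr [ch close]] := frame_chain vV v_complete F_integral F_monic Frs theta_rs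
  s_frame phi_approx.
have [nearF repF] := maclane_chain vV v_complete v_normal F_monic Frs theta_rs theta0 ch.
have size_deg (g : {poly k}) : g != 0 -> size g = (deg g).+1.
  by move=> g0; rewrite /deg prednK // size_poly_gt0.
have phi_size : size phi = size F by rewrite !size_deg ?monic_neq0 // phi_deg.
have phi_irr := approx_irr vV v_complete F_monic Frs theta_rs nearF phi_monic phi_size close.
have [ps phis] := conjugatesP iota phi_monic phi_irr.
have eta_ps : eta \in ps by rewrite -(conj_mem phis).
have chphi := chain_approx vV v_complete F_monic Frs theta_rs nearF phi_monic
  phi_size close ch.
have [_ repP] := maclane_chain vV v_complete v_normal phi_monic phis eta_ps eta0 chphi.
have nF : (size F).-1 = size rs by rewrite (conj_size Frs).
have rps : size rs = size ps.
  by apply: succn_inj; rewrite -(conj_size Frs) -(conj_size phis) phi_size.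
have evE (g : {poly k}) : (size g <= size rs)%N ->
    v (peval iota g theta) = v (peval iota g eta).
  rewrite -nF => gs; symmetry.
  exact: (approx_eval vV v_complete F_monic Frs theta_rs nearF phi_monic phi_size close).
have eE := ramification_index_eq iota (value_group_eq Frs theta_rs phis eta_ps rps evE).
have muE : mu iota v F theta = mu iota v phi eta.
  apply: mu_eq => // g gd; apply: evE.
  have [->|g0] := eqVneq g 0; first by rewrite size_poly0.
  by rewrite size_deg // -nF.
have dsize (G : {poly k}) : size G = size F -> (size G^`() <= size rs)%N.
  move=> GF; rewrite -nF -ltnS prednK ?size_poly_gt0 ?monic_neq0 // -GF.
  by apply: lt_size_deriv; rewrite -size_poly_gt0 GF size_poly_gt0 monic_neq0.
have dF0 := deriv_neq0 Frs F_sep theta_rs.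
have dphi0 := deriv_neq0 phis phi_sep eta_ps.
set E := ramification_index iota v (adjoin iota theta) in repF eE.
have E0 : 0 < E%:R :> rat by rewrite ltr0n; exact: rep_gt0 repF.
have macF (g : {poly k}) : g != 0 -> (size g <= size rs)%N ->
    maclane iota v F s g = (E%:R * rval v (peval iota g theta))%:E.
  rewrite -nF => g0 gs; have [t _ h] := near_gaussv vV nearF g0 gs F_theta.
  exact: rep_val repF _ _ _ h.
have neq0 (g : {poly k}) x : peval iota g x != 0 -> g != 0.
  by apply: contraNneq => ->; rewrite peval0.
have deriv_eq : v (peval iota phi^`() theta) = v (peval iota F^`() theta).
  have [/eqP|g0] := eqVneq (F - phi) 0; first by rewrite subr_eq0 => /eqP ->.
  have gs : (size (F - phi)%R <= size rs)%N.
    by rewrite -nF -opprB size_polyN; apply: approx_diff_size.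
  move: gs g0; set g := F - phi => gs g0.
  have [M ME Mle] : exists2 M : rat, mu iota v F theta = M%:E
      & M <= rootsum v theta dr rs - dr.
    have [|w wd] := chain_value ch; first by exists 1; exact: v1 vV.
    have bound := mu_bound vV v_complete Frs theta_rs theta0 wd nearF.
    have [->|[h [hm hd ->]]] := mu_cases iota v F theta.
      (* The default value 0 is the value of the polynomial 1, so it obeys the same bound. *)
      exists 0 => //; rewrite -lee_fin -(v1 vV) -(peval1 iota theta).
      by apply: bound; rewrite ?monic1 // size_poly1 (conj_gt0 Frs).
    have hs : (size h <= size rs)%N by rewrite size_deg ?monic_neq0 // -nF.
    have le := bound _ hm hs; exists (rval v (peval iota h theta)).
      by apply: (vE vV); exact: v_le_fin le.
    by rewrite -lee_fin -(vE vV) // (v_le_fin vV le).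
  have [t gphi] := approx_gaussv vV v_complete F_monic Frs theta_rs nearF phi_monic
    phi_size close F_theta.
  move: h_gt; rewrite /rho /hphi (macF _ g0 gs) (rep_val repF gphi).
  rewrite macF ?dsize ?(neq0 _ _ dF0) // -/E ME -!EFinM -!EFinB lte_fin => hlt.
  have gE : rval v (peval iota g theta) - dr > rval v (peval iota F^`() theta).
    by rewrite -(ltr_pM2l E0); have := ler_wpM2l (ltW E0) Mle; lra.
  have gs' : (size g <= (size F).-1)%N by rewrite nF.
  (* The Taylor coefficient of index 1 of [g] is its derivative at [theta]; its value is at least
     the Gauss value of [g] minus [dr]. *)
  have [u _ [lo _ _]] := near_gaussv vV nearF g0 gs' F_theta.
  have := lo 1%N; rewrite mul1r coef1_shift deriv_map => lo1.
  have -> : phi^`() = F^`() - g^`() by rewrite derivB subKr.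
  rewrite pevalB (v_add_lt vV) // (vN vV) (vE vV dF0).
  by apply: lt_le_trans lo1; rewrite lte_fin.
have deriv_eq' : v (peval iota F^`() theta) = v (peval iota phi^`() eta).
  by rewrite -deriv_eq; apply: evE; exact: dsize.
split; last exact: (ideal_valuation_different_eq vV Frs F_sep theta_rs phis phi_sep).
rewrite /rho -muE -eE; congr (_ - _)%E.
have nearP : near iota v phi dr (size phi).-1.
  by have [] := maclane_chain vV v_complete v_normal phi_monic phis eta_ps eta0 chphi.
have [|t _ h] := near_gaussv vV nearP (neq0 _ _ dphi0) _ phi_eta.
  by rewrite phi_size nF; exact: dsize.
rewrite (rep_val repP h) -eE macF ?dsize ?(neq0 _ _ dF0) //.
by rewrite /rval deriv_eq'.
Qed.
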